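(* Let $\Phi$ be an Orlicz function with conjugate function $\Phi'$. Suppose that $$\Phi(au)\le K_1a^2\Phi(u)$$ for some $K_1>0$ and all $a\ge1$, $u\ge1$, and moreover that $$\Phi'(u+v)\le K_2\Phi'(u)\Phi'(v)$$ for some $K_2>0$ and all $u\ge1$, $v\ge1$. Then there exists $c>0$, depending only on $\Phi$, such that for an arbitrary collection of mean zero independent functions $\{f_k\}_{k=1}^N$ from the Orlicz space $L_\Phi$, with $\|f_k\|_{L_\Phi}\ge1$, $k=1,\dots,N$, and any $n<N$, the following inequality holds: $$d_n^{\mathrm{avg}}(\{f_1,\dots,f_N\},L_\Phi)_2\ge c\,(1-n/N)^{1/2}.$$ In particular, this is true for the space $L\log^\alpha L$ if $\alpha\ge1$.
   Context: Functions are real-valued and Lebesgue measurable on $[0,1]$; independence is with respect to Lebesgue measure; mean zero means $\int_0^1f_k(t)\,dt=0$. Orlicz function: a strictly increasing, convex, continuous $\Phi:[0,\infty)\to[0,\infty)$ with $\Phi(0)=0$, $\Phi(1)=1$. Orlicz space $L_\Phi$: all measurable $x$ on $[0,1]$ with finite Luxemburg norm $\|x\|_{L_\Phi}:=\inf\{\lambda>0:\int_0^1\Phi(|x(t)|/\lambda)\,dt\le1\}$. Conjugate function: $\Phi'(u):=\sup_{t>0}(ut-\Phi(t))$, $u>0$. $L\log^\alpha L$, $\alpha>0$, denotes the Orlicz space generated by an Orlicz function equivalent, for large $u$, to $u\ln^\alpha u$. Averaged width: $d_n^{\mathrm{avg}}(\{x_1,\ldots,x_N\},X)_2:=\inf_{\dim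 V\le n}\big(\frac1N\sum_{k=1}^N\rho(x_k,V)^2\big)^{1/2}$, where $\rho(x,V)=\inf_{v\in V}\|x-v\|_X$ and the infimum is over linear subspaces $V\subset X$ of dimension at most $n$. *)

(* Defs.v *)
From HB Require Import structures.
From mathcomp Require Import all_boot all_order all_algebra.
From mathcomp Require Import all_classical all_reals all_analysis.

Set Implicit Arguments.
Unset Strict Implicit.
Unset Printing Implicit Defensive.

Import Order.TTheory GRing.Theory Num.Theory.
Import numFieldNormedType.Exports.

Local Open Scope classical_set_scope.
Local Open Scope ring_scope.

(* Only the values on [0, +oo[ are meaningful. *)
Record orlicz_function {R : realType} (Phi : R -> R) : Prop := OrliczFunction {
  orlicz_ge0 : forall u : R, 0 <= u -> 0 <= Phi u ;
  orlicz_increasing : {in `[0, +oo[ &, {homo Phi : u v / u < v}} ;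
  orlicz_convex : convex_function (`[0, +oo[%classic : set R) Phi ;
  orlicz_continuous : {within `[0, +oo[, continuous Phi} ;
  orlicz0 : Phi 0 = 0 ;
  orlicz1 : Phi 1 = 1 }.

(* Extended-real valued: for instance it is +oo at every u > 1 when Phi is the
   identity. *)
Definition orlicz_conjugate {R : realType} (Phi : R -> R) (u : R) : \bar R :=
  ereal_sup [set (u * t - Phi t)%:E | t in `]0, +oo[].

(* Phi is equivalent, for large u, to u ln^alpha u. *)
Definition equiv_LlogL {R : realType} (alpha : R) (Phi : R -> R) : Prop :=
  exists2 C : R, 0 < C & \forall u \near +oo,
    C^-1 * (u * ln u `^ alpha) <= Phi u <= C * (u * ln u `^ alpha).

Section orlicz_space.
Context d (T : measurableType d) (R : realType).
Variables (mu : {measure set T -> \bar R}) (D : set T).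

(* Equal to +oo when no l is admissible. *)
Definition luxemburg (Phi : R -> R) (x : T -> R) : \bar R :=
  ereal_inf [set l%:E | l in
    [set l : R | 0 < l /\ (\int[mu]_(t in D) (Phi (`|x t| / l))%:E <= 1)%E]].

Definition orlicz_space (Phi : R -> R) : set (T -> R) :=
  [set x | measurable_fun D x /\ (luxemburg Phi x < +oo)%E].

(* Elements of the Orlicz space are represented by functions; the dimension is
   that of the image in the quotient by almost everywhere equality on D. *)
Definition subspace_dim_le (n : nat) (V : set (T -> R)) : Prop :=
  [/\ V (cst 0),
      forall (a : R) u v, V u -> V v -> V (fun t => a * u t + v t) &
      exists2 g : 'I_n -> T -> R, (forall i, V (g i)) &
        forall v, V v -> exists a : 'I_n -> R,
          {ae mu, forall t, D t -> v t = \sum_(i < n) a i * g i t}].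

Definition orlicz_dist (Phi : R -> R) (x : T -> R) (V : set (T -> R)) : \bar R :=
  ereal_inf [set luxemburg Phi (fun t => x t - v t) | v in V].

Definition avg_width (n N : nat) (x : 'I_N -> T -> R) (Phi : R -> R) : \bar R :=
  ereal_inf [set sqrte ((N%:R^-1)%:E * \sum_(k < N) orlicz_dist Phi (x k) V ^+ 2)%E
    | V in [set V | V `<=` orlicz_space Phi /\ subspace_dim_le n V]].

(* Taking some B k equal to setT gives the product rule for subfamilies when D
   has measure 1. *)
Definition independent_on (N : nat) (f : 'I_N -> T -> R) : Prop :=
  forall B : 'I_N -> set R, (forall k, measurable (B k)) ->
    mu (D `&` \bigcap_(k in [set: 'I_N]) f k @^-1` B k)
    = (\prod_(k < N) mu (D `&` f k @^-1` B k))%E.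

End orlicz_space.

(* R with the sigma-algebra of Lebesgue measurable sets. *)
Definition lebesgueType (R : realType) : measurableType _ :=
  caratheodory_type ((@wlength R idfun)^*)%mu.

Definition unit_itv (R : realType) : set (lebesgueType R) := `[0, 1]%classic.
Arguments unit_itv : clear implicits.

(* The constant c may depend on Phi only. *)
Definition avg_width_bounded_below {R : realType} (Phi : R -> R) : Prop :=
  exists2 c : R, 0 < c &
    forall (N n : nat) (f : 'I_N -> lebesgueType R -> R),
      (n < N)%N ->
      (forall k, orlicz_space completed_lebesgue_measure (unit_itv R) Phi (f k)) ->
      (forall k, (1 <= luxemburg completed_lebesgue_measure (unit_itv R) Phi (f k))%E) ->
      (forall k, (\int[completed_lebesgue_measure]_(t in unit_itv R) (f k t)%:E = 0)%E) ->
      independent_on completed_lebesgue_measure (unit_itv R) f ->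
      ((c * Num.sqrt (1 - n%:R / N%:R))%:E
         <= avg_width completed_lebesgue_measure (unit_itv R) n f Phi)%E.

(* Main.v *)
Require Import Defs.
From mathcomp Require Import all_boot all_order all_algebra.
From mathcomp Require Import all_classical all_reals all_analysis.
From mathcomp Require Import measurable_realfun ring lra.

Set Implicit Arguments.
Unset Strict Implicit.
Unset Printing Implicit Defensive.

Import Order.TTheory GRing.Theory Num.Theory.
Import numFieldNormedType.Exports.

Local Open Scope classical_set_scope.
Local Open Scope ring_scope.

(* Replace the conjugate function of Phi by a submultiplicative gauge M that
   grows at least quadratically and satisfies u v <= C (Phi u + M v).  A norm
   bound on each f_k from below yields a bounded centred function G_k (f_k) with
   <f_k, G_k (f_k)> = e and bounded M-mass.  By independence and the inequality
   weight M (a y) <= 1 + b a y + O(a^2) M |y|, every normalized combination of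
   the G_k (f_k) also has bounded M-mass, so that Young's inequality gives a
   Bessel inequality: the coefficients <h, G_k (f_k)> have l2-norm at most
   C3 |h|.  If v_j in V approximates f_j, the matrix <f_j - v_j, G_k (f_k)> is e
   times the identity minus a matrix of rank at most n, hence its squared
   Hilbert-Schmidt norm is at least e^2 (N - n), while the Bessel inequality
   bounds it above by C3^2 times the sum of the squared distances. *)

(** * Low-rank perturbations of scalar matrices *)

(** The gauge serves both claims at once: for general [Phi] it is a multiple of the conjugate,
    frozen below 1 where nothing is assumed about it; for L log^alpha L it is an explicit
    exponential, so that no conjugate has to be computed. Each [G_k] is explicit too: a truncated,
    centred multiple of the secant slope Phi (2 |t|) / (2 |t|) carrying the sign of t. This replaces
    any appeal to a duality theorem or to a derivative of [Phi]. The constant depends on [Phi] alone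
    because the sup bound of [G_k], which does depend on [f_k], is used only for integrability;
    every estimate goes through the mass of [M |G_k (f_k)|]. *)

Definition sqnorm_mx {R : realType} m n (B : 'M[R]_(m, n)) : R :=
  \sum_i \sum_j B i j ^+ 2.

Lemma sqnorm_mxE (R : realType) m n (B : 'M[R]_(m, n)) :
  sqnorm_mx B = \tr (B *m B^T).
Proof.
apply: eq_bigr => i _; rewrite mxE; apply: eq_bigr => j _.
by rewrite mxE expr2.
Qed.

Lemma sqnorm_mx_ge0 (R : realType) m n (B : 'M[R]_(m, n)) : 0 <= sqnorm_mx B.
Proof. by apply: sumr_ge0 => i _; apply: sumr_ge0 => j _; exact: sqr_ge0. Qed.

Lemma sqnorm_mx_eq0 (R : realType) m n (B : 'M[R]_(m, n)) :
  sqnorm_mx B = 0 -> B = 0.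
Proof.
move=> /eqP; rewrite psumr_eq0; last first.
  by move=> i _; apply: sumr_ge0 => j _; exact: sqr_ge0.
move=> /allP B0; apply/matrixP => i j; rewrite mxE.
have /implyP/(_ isT) := B0 i (mem_index_enum _).
rewrite psumr_eq0; last by move=> k _; exact: sqr_ge0.
by move=> /allP/(_ j (mem_index_enum _)); rewrite sqrf_eq0 => /eqP.
Qed.

(** Positive definiteness: if L K K^T = 0, then the squared norm of L K, which is the trace of L K
    K^T L^T, vanishes. *)
Lemma gram_unitmx (R : realType) m n (K : 'M[R]_(m, n)) :
  row_free K -> K *m K^T \in unitmx.
Proof.
move=> Kfree; rewrite -row_free_unit -kermx_eq0; apply/eqP.
set L := kermx _; have LK0 : L *m K *m K^T = 0 by rewrite -mulmxA mulmx_ker.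
have : L *m K = 0.
  by apply: sqnorm_mx_eq0; rewrite sqnorm_mxE trmx_mul mulmxA LK0 mul0mx mxtrace0.
by move=> /eqP; rewrite mulmx_free_eq0// => /eqP.
Qed.

(** [P] is the orthogonal projector onto the row space of [K]. It is used with rows of [K] spanning
    the left kernel of a matrix [A], hence the last clause. *)
Lemma gram_projector (R : realType) m n (K : 'M[R]_(m, n)) : row_free K ->
  exists P : 'M[R]_n, [/\ P^T = P, P *m P = P, \tr P = m%:R &
    forall A : 'M[R]_n, K *m A = 0 -> P *m A = 0].
Proof.
move=> /gram_unitmx Ku; exists (K^T *m invmx (K *m K^T) *m K); split.
- by rewrite !trmx_mul trmxK trmx_inv trmx_mul trmxK mulmxA.
- by rewrite -!mulmxA (mulmxA K K^T) mulKmx.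
- by rewrite -mulmxA mxtrace_mulC -mulmxA mulVmx// mxtrace1.
- by move=> A KA; rewrite -mulmxA KA mulmx0.
Qed.

(** The orthogonal projector [P] attached to the left kernel of [A] has trace at least N - n, and P
    B = e P for B = e I - A. Expanding |B - e P|^2 >= 0 then leaves |B|^2 >= e^2 tr P. *)
Lemma sqnorm_scalar_sub_low_rank (R : realType) n N (e : R) (A : 'M[R]_N) :
  (\rank A <= n)%N -> e ^+ 2 * (N%:R - n%:R) <= sqnorm_mx (e%:M - A).
Proof.
move=> rA.
have [P [PT PP trP PA]] := gram_projector (row_base_free (kermx A)).
have {}PA : P *m A = 0.
  by apply: PA; apply/sub_kermxP; rewrite eq_row_base.
have {}trP : N%:R - n%:R <= \tr P.
  by rewrite trP mxrank_ker natrB ?rank_leq_row// lerB// ler_nat.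
set B := e%:M - A.
have PB : P *m B = e *: P by rewrite /B mulmxBr PA subr0 mul_mx_scalar.
have BP : B^T *m P = e *: P.
  by rewrite -[in LHS]PT -trmx_mul PB linearZ/= PT.
clearbody B; have := sqnorm_mx_ge0 (B - e *: P); rewrite sqnorm_mxE.
have -> : (B - e *: P)^T = B^T - e *: P by rewrite linearB/= linearZ/= PT.
rewrite mulmxBl !mulmxBr -!scalemxAl -!scalemxAr PP.
rewrite !raddfB/= !linearZ/=.
have -> : \tr (P *m B^T) = e * \tr P.
  by rewrite mxtrace_mulC BP linearZ.
have -> : \tr (B *m P) = e * \tr P.
  by rewrite mxtrace_mulC PB linearZ.
rewrite -sqnorm_mxE => h.
have : e ^+ 2 * (N%:R - n%:R) <= e ^+ 2 * \tr P by rewrite ler_wpM2l// sqr_ge0.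
by move: h; rewrite /GRing.scale/=; lra.
Qed.

(** * Submultiplicative gauges *)

(** The condition 1 <= a * u excludes small arguments, where M >= 1 rules out quadratic decay. *)
Record gauge {R : realType} (C : R) (M : R -> R) : Prop := Gauge {
  gauge_ge1 : forall u, 1 <= M u ;
  gauge_homo : {homo M : u v / u <= v} ;
  gaugeD : forall u v, 0 <= u -> 0 <= v -> M (u + v) <= M u * M v ;
  gauge_quad : forall a u, 0 < a <= 1 -> 1 <= a * u ->
    M (a * u) <= C * a ^+ 2 * M u }.

(** The source is exp z (1 - z) <= 1. For z >= 0, multiply by 1 + z and move z^2 exp z to the right;
    for z < 0, divide by 1 - z. *)
Lemma expR_le_quadratic (R : realType) (b z : R) : `|z| <= b ->
  expR z <= 1 + z + z ^+ 2 * expR b.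
Proof.
move=> zb; have b0 : 0 <= b := le_trans (normr_ge0 _) zb.
have eb : 1 <= expR b by rewrite -expR0 ler_expR.
have ez := expR_gt0 z.
have [z0|z0] := leP 0 z.
  have zeb : expR z <= expR b by rewrite ler_expR -(ger0_norm z0).
  have h : expR z * (1 - z ^+ 2) <= 1 + z.
    have [z1|z1] := leP 1 z.
      have : 1 - z ^+ 2 <= 0 by nra.
      by nra.
    have : expR z * (1 - z) <= expR z * expR (- z).
      by rewrite ler_pM2l//; exact: expR_ge1Dx.
    by rewrite expRxMexpNx_1; nra.
  have : z ^+ 2 * expR z <= z ^+ 2 * expR b by rewrite ler_wpM2l// sqr_ge0.
  lra.
have h : expR z * (1 - z) <= 1.
  by rewrite -[leRHS](expRxMexpNx_1 z) ler_pM2l//; exact: expR_ge1Dx.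
have : z ^+ 2 <= z ^+ 2 * expR b by rewrite ler_peMr// sqr_ge0.
suff : expR z <= 1 + z + z ^+ 2 by lra.
have z1 : 0 < 1 - z by lra.
rewrite -(ler_pM2r z1) (le_trans h)//.
(* Because (1 - z) (1 + z + z^2) = 1 - z^3. *)
have : 0 <= - z ^+ 3 by rewrite oppr_ge0 exprn_odd_le0// ltW.
rewrite !exprS expr0; nra.
Qed.

(* Multiplicative majorant of M: exponential on small terms, where the linear
   term can cancel in the mean, and M itself on large terms. *)
Definition weight {R : realType} (M : R -> R) (x : R) : R :=
  if `|x| <= 1 then expR (ln (M 1) * x) else M `|x|.

Section gauge_theory.
Context (R : realType) (C : R) (M : R -> R).
Hypothesis (C1 : 1 <= C) (gM : gauge C M).
Let b := ln (M 1).

Lemma gauge_gt0 u : 0 < M u.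
Proof. exact: lt_le_trans (gauge_ge1 gM u). Qed.

Let b_ge0 : 0 <= b. Proof. by rewrite ln_ge0// (gauge_ge1 gM). Qed.
Let eb : expR b = M 1. Proof. by rewrite lnK// posrE gauge_gt0. Qed.

Lemma weight_gt0 (x : R) : 0 < weight M x.
Proof. by rewrite /weight; case: ifP => _; rewrite ?expR_gt0// gauge_gt0. Qed.

Lemma gauge_nat (n : nat) : M n.+1%:R <= expR (b * n.+1%:R).
Proof.
elim: n => [|n ih]; first by rewrite mulr1 eb.
rewrite -natr1 mulrDr mulr1 expRD (le_trans (gaugeD gM _ _))//.
by rewrite eb ler_pM// ltW// gauge_gt0.
Qed.

Lemma gauge_le_expR u : 0 <= u -> M u <= M 1 * expR (b * u).
Proof.
move=> u0; have /andP[lo hi] := truncn_itv u0.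
apply: (le_trans (gauge_homo gM (ltW hi))).
apply: (le_trans (gauge_nat _)).
by rewrite -eb -expRD ler_expR -{2}[b]mulr1 -mulrDr ler_wpM2l// -natr1 addrC lerD2l.
Qed.

(** The shift [s] accumulates the small terms, while a large term is split off by
    submultiplicativity. Bounding exp (b |s|) by exp (b s) + exp (- b s) costs a second product but
    keeps the linear terms signed. *)
Lemma gauge_norm_sum_le (I : Type) (r : seq I) (x : I -> R) (s : R) :
  M `|s + \sum_(i <- r) x i| <=
    M 1 * (expR (b * s) * \prod_(i <- r) weight M (x i)
         + expR (- (b * s)) * \prod_(i <- r) weight M (- x i)).
Proof.
elim: r s => [|i r ih] s.
  rewrite !big_nil addr0 !mulr1 (le_trans (gauge_le_expR _))//.
  rewrite ler_pM2l ?gauge_gt0//; have [s0|s0] := leP 0 s.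
    by rewrite ger0_norm// lerDl expR_ge0.
  by rewrite ltr0_norm// mulrN lerDr expR_ge0.
rewrite !big_cons; have [xi|xi] := leP `|x i| 1.
  have -> : weight M (x i) = expR (b * x i) by rewrite /weight xi.
  have -> : weight M (- x i) = expR (- (b * x i)).
    by rewrite /weight normrN xi mulrN.
  rewrite addrA (le_trans (ih _))// (mulrDr b) opprD !expRD; lra.
rewrite addrCA; have tri := ler_normD (x i) (s + \sum_(j <- r) x j).
apply: (le_trans (gauge_homo gM tri)).
apply: (le_trans (gaugeD gM (normr_ge0 _) (normr_ge0 _))).
apply: (le_trans (ler_wpM2l (ltW (gauge_gt0 _)) (ih s))).
have -> : weight M (x i) = M `|x i| by rewrite /weight leNgt xi.
have -> : weight M (- x i) = M `|x i| by rewrite /weight normrN leNgt xi.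
lra.
Qed.

Lemma sqr_le_gauge (y : R) : y ^+ 2 <= C * M `|y|.
Proof.
have M1 := gauge_ge1 gM `|y|.
rewrite -real_normK ?num_real//.
have [y1|y1] := leP `|y| 1.
  apply: (@le_trans _ _ 1); first by rewrite exprn_ile1.
  by rewrite mulr_ege1.
(* Rescaling by a = 1 / |y| brings the argument to exactly 1, where M is at least 1. *)
have y0 : 0 < `|y| by lra.
have := gauge_quad gM (a := `|y|^-1) (u := `|y|).
rewrite invr_gt0 y0 invf_le1// (ltW y1) mulVf ?gt_eqF// => /(_ isT (lexx _)).
have := gauge_ge1 gM 1; set m := M 1 => m1 h.
have : m * `|y| ^+ 2 <= C * M `|y|.
  rewrite -ler_pdivlMr ?exprn_gt0//; apply: le_trans h _.
  by rewrite exprVn mulrAC.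
by apply: le_trans; rewrite ler_peMl// sqr_ge0.
Qed.

Lemma norm_le_gauge (y : R) : `|y| <= C * M `|y|.
Proof.
have M1 := gauge_ge1 gM `|y|.
have [y1|y1] := leP `|y| 1; first by rewrite (le_trans y1)// mulr_ege1.
apply: le_trans (sqr_le_gauge y); rewrite -real_normK ?num_real// expr2.
by rewrite ler_peMl// ltW.
Qed.

(** The summand 1 pays for [gauge_quad] on large terms, b for the linear term there, and b^2 M 1 for
    the quadratic remainder on small terms, where exp b = M 1. *)
Definition weight_cst := C * (1 + b + b ^+ 2 * M 1).

Lemma weight_cst_ge0 : 0 <= weight_cst.
Proof.
rewrite mulr_ge0//; first by rewrite (le_trans _ C1).
by rewrite !addr_ge0// mulr_ge0 ?sqr_ge0// ltW// gauge_gt0.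
Qed.

Lemma weight_scale_le (a y : R) : `|a| <= 1 ->
  weight M (a * y) <= 1 + b * a * y + weight_cst * a ^+ 2 * M `|y|.
Proof.
move=> a1; have yC := sqr_le_gauge y; have Mp := gauge_gt0 `|y|.
have a2 : 0 <= a ^+ 2 := sqr_ge0 a.
have CM : 0 <= C * M `|y| by rewrite mulr_ge0// ltW// (lt_le_trans _ C1).
have aCM : 0 <= a ^+ 2 * (C * M `|y|) by rewrite mulr_ge0.
have M1 := gauge_gt0 1.
rewrite /weight; case: ifP => [ay|/negbT].
  have h : `|b * (a * y)| <= b.
    by rewrite normrM (ger0_norm b_ge0) -{2}[b]mulr1 ler_wpM2l.
  apply: (le_trans (expR_le_quadratic h)); rewrite eb.
  have : (b * (a * y)) ^+ 2 * M 1 <= b ^+ 2 * M 1 * (a ^+ 2 * (C * M `|y|)).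
    rewrite exprMn mulrAC exprMn ler_wpM2l//; last by rewrite ler_wpM2l.
    by rewrite mulr_ge0 ?sqr_ge0// ltW.
  have : 0 <= b * (a ^+ 2 * (C * M `|y|)) by rewrite mulr_ge0.
  by rewrite /weight_cst; lra.
rewrite -ltNge => ay.
have a0 : 0 < `|a|.
  by rewrite normr_gt0; apply: contraTneq ay => ->; rewrite mul0r normr0 ltr10.
have := gauge_quad gM (a := `|a|) (u := `|y|).
rewrite a0 a1 -normrM (ltW ay) real_normK ?num_real// => /(_ isT isT) h.
(* The linear term may be negative; since |a y| > 1, its size is at most b (a y)^2. *)
have : - (b * a * y) <= b * (a ^+ 2 * (C * M `|y|)).
  rewrite -mulrA -mulrN ler_wpM2l//.
  apply: (@le_trans _ _ (a ^+ 2 * y ^+ 2)); last by rewrite ler_wpM2l.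
  apply: le_trans (ler_norm _) _; rewrite normrN -exprMn.
  by rewrite -[leRHS]real_normK ?num_real// expr2 ler_peMl// ltW.
have : 0 <= b ^+ 2 * M 1 * (a ^+ 2 * (C * M `|y|)).
  by rewrite mulr_ge0// mulr_ge0 ?sqr_ge0// ltW.
by rewrite /weight_cst; lra.
Qed.

End gauge_theory.

(** * Independence *)

Section independence.
Context d (T : measurableType d) (R : realType).
Variables (mu : {measure set T -> \bar R}) (D : set T).
Hypothesis mD : measurable D.

Import HBNNSimple.

(** Extension from indicators to simple functions to monotone limits. In the application [h] is the
    product of the factors of the other variables and [c] the product of their integrals. *)
Lemma integral_mul_comp (h : T -> R) (c : R) (f : T -> R) :
  measurable_fun D h -> measurable_fun D f -> (forall x, 0 <= h x) ->
  (forall B, measurable B ->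
    (\int[mu]_(x in D) (h x * \1_B (f x))%:E
      = c%:E * \int[mu]_(x in D) (\1_B (f x))%:E)%E) ->
  forall W : R -> R, measurable_fun setT W -> (forall y, 0 <= W y) ->
  (\int[mu]_(x in D) (h x * W (f x))%:E
    = c%:E * \int[mu]_(x in D) (W (f x))%:E)%E.
Proof.
move=> mh mf h0 hB W mW W0.
have mfB B : measurable B -> measurable_fun D (fun x => \1_B (f x) : R).
  by move=> mB; apply: (measurableT_comp (f := \1_B : R -> R)) => //.
have simple (p : {nnsfun R >-> R}) :
    (\int[mu]_(x in D) (h x * p (f x))%:E
      = c%:E * \int[mu]_(x in D) (p (f x))%:E)%E.
  set s := finmap.enum_fset (fset_set (range p)).
  have pE y : p y = \sum_(i < size s) s`_i * \1_(p @^-1` [set s`_i]) y.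
    exact: fimfunEord.
  have s0 (i : 'I_(size s)) : 0 <= s`_i.
    have : s`_i \in s by exact: mem_nth.
    by rewrite /s in_fset_set// inE => -[y _ <-].
  have mB (i : 'I_(size s)) : measurable (p @^-1` [set s`_i]).
    exact: measurable_funPTI.
  under eq_integral do rewrite pE mulr_sumr -sumEFin.
  under [in RHS]eq_integral do rewrite pE -sumEFin.
  rewrite ge0_integral_sum//; [|move=> i|by move=> i x _; rewrite lee_fin !mulr_ge0].
    2: by apply/measurable_EFinP; apply: measurable_funM => //;
      apply: measurable_funM => //; exact: mfB.
  rewrite ge0_integral_sum//; [|move=> i|by move=> i x _; rewrite lee_fin !mulr_ge0].
    2: by apply/measurable_EFinP; apply: measurable_funM => //; exact: mfB.
  rewrite ge0_sume_distrr; last first.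
    by move=> i _; apply: integral_ge0 => x _; rewrite lee_fin mulr_ge0.
  apply: eq_bigr => i _.
  under eq_integral do rewrite mulrCA EFinM.
  under [in RHS]eq_integral do rewrite EFinM.
  rewrite ge0_integralZl_EFin//; first last.
  - by apply/measurable_EFinP; apply: measurable_funM => //; exact: mfB.
  - by move=> x _; rewrite lee_fin mulr_ge0.
  rewrite ge0_integralZl_EFin//; first last.
  - by apply/measurable_EFinP; exact: mfB.
  by rewrite hB// muleCA.
have mWE : measurable_fun setT (EFin \o W) by exact/measurable_EFinP.
pose p := nnsfun_approx measurableT mWE.
have p_cvg y : (p n y)%:E @[n --> \oo] --> (W y)%:E.
  by apply: (@cvg_nnsfun_approx _ _ _ _ measurableT _ mWE) => // z _; rewrite lee_fin.
have p_nd y m n : (m <= n)%N -> p m y <= p n y.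
  by move=> mn; exact/lefP/nd_nnsfun_approx.
have lim1 : (\int[mu]_(x in D) (h x * p n (f x))%:E)%E @[n --> \oo] -->
    (\int[mu]_(x in D) (h x * W (f x))%:E)%E.
  rewrite (_ : (\int[mu]_(x in D) (h x * W (f x))%:E)%E =
      (\int[mu]_(x in D) limn (fun n => (h x * p n (f x))%:E))%E).
    apply: (@cvg_monotone_convergence _ _ _ mu D mD (fun n x => (h x * p n (f x))%:E)) => //.
    - move=> n; apply/measurable_EFinP; apply: measurable_funM => //.
      exact: measurableT_comp.
    - by move=> n x _; rewrite lee_fin mulr_ge0.
    - by move=> x _ m n mn; rewrite lee_fin ler_wpM2l// p_nd.
  apply: eq_integral => x _; apply/esym/cvg_lim => //.
  under eq_fun do rewrite EFinM.
  by rewrite EFinM; apply: cvgeZl.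
have lim2 : (\int[mu]_(x in D) (p n (f x))%:E)%E @[n --> \oo] -->
    (\int[mu]_(x in D) (W (f x))%:E)%E.
  rewrite (_ : (\int[mu]_(x in D) (W (f x))%:E)%E =
      (\int[mu]_(x in D) limn (fun n => (p n (f x))%:E))%E).
    apply: (@cvg_monotone_convergence _ _ _ mu D mD (fun n x => (p n (f x))%:E)) => //.
    - by move=> n; apply/measurable_EFinP; exact: measurableT_comp.
    - by move=> n x _; rewrite lee_fin.
    - by move=> x _ m n mn; rewrite lee_fin p_nd.
  by apply: eq_integral => x _; apply/esym/cvg_lim.
have {}lim2 : (c%:E * \int[mu]_(x in D) (p n (f x))%:E)%E @[n --> \oo] -->
    (c%:E * \int[mu]_(x in D) (W (f x))%:E)%E.
  exact: cvgeZl.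
rewrite (_ : (fun n : nat => _) = (fun n => (c%:E * \int[mu]_(x in D) (p n (f x))%:E)%E)) in lim1.
  exact: cvg_unique lim1 lim2.
by apply/funext => n; exact: simple.
Qed.

End independence.

Section independence_product.
Context d (T : measurableType d) (R : realType).
Variables (mu : {measure set T -> \bar R}) (D : set T).
Hypotheses (mD : measurable D) (muD : mu D = 1%E).

Lemma integral_indic_set (A : set T) : measurable (D `&` A) ->
  (\int[mu]_(x in D) (\1_(D `&` A) x)%:E = mu (D `&` A))%E.
Proof. by move=> mDA; rewrite integral_indic// setIAC setIid. Qed.

Lemma integral_indic_comp (f : T -> R) (B : set R) : measurable_fun D f ->
  measurable B ->
  (\int[mu]_(x in D) (\1_B (f x))%:E = mu (D `&` f @^-1` B))%E.
Proof.
move=> mf mB; have mDB : measurable (D `&` f @^-1` B) by exact: mf.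
rewrite -integral_indic_set//; apply: eq_integral => x; rewrite inE => Dx.
by rewrite !indicE in_setI (mem_set Dx)/=; congr (_%:R%:E); apply/idP/idP; rewrite !inE.
Qed.

Lemma integral_prod_independent N (f : 'I_N -> T -> R) (W : 'I_N -> R -> R) :
  (forall k, measurable_fun D (f k)) -> independent_on mu D f ->
  (forall k, measurable_fun setT (W k)) -> (forall k y, 0 <= W k y) ->
  (forall k, (\int[mu]_(x in D) (W k (f k x))%:E < +oo)%E) ->
  (\int[mu]_(x in D) (\prod_(k < N) W k (f k x))%:E
    = \prod_(k < N) \int[mu]_(x in D) (W k (f k x))%:E)%E.
Proof.
move=> mf indep mW W0 Wfin.
(* One coordinate at a time is upgraded from an indicator to a general W. *)
suff replace_on (s : seq 'I_N) : forall V : 'I_N -> R -> R,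
    (forall k, measurable_fun setT (V k)) -> (forall k y, 0 <= V k y) ->
    (forall k, (\int[mu]_(x in D) (V k (f k x))%:E < +oo)%E) ->
    (forall k, k \notin s -> exists2 B, measurable B & V k = \1_B) ->
    (\int[mu]_(x in D) (\prod_(k < N) V k (f k x))%:E
      = \prod_(k < N) \int[mu]_(x in D) (V k (f k x))%:E)%E.
  by apply: (replace_on (enum 'I_N)) => // k; rewrite mem_enum.
elim: s => [|a s ih] V mV V0 Vfin Vs.
  have /choice[B BP] : forall k, exists B, measurable B /\ V k = \1_B.
    by move=> k; have [B mB VB] := Vs k isT; exists B.
  have -> : (\prod_(k < N) \int[mu]_(x in D) (V k (f k x))%:E)%E
      = (\prod_(k < N) mu (D `&` f k @^-1` B k))%E.
    apply: eq_bigr => k _; have [mB ->] := BP k.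
    by rewrite integral_indic_comp.
  rewrite -indep; last by move=> k; have [] := BP k.
  set E := \bigcap_(k in _) _.
  have mI : measurable (D `&` E).
    rewrite (_ : _ `&` _ = D `&` \bigcap_(k in [set: 'I_N]) (D `&` f k @^-1` B k)).
      apply: measurableI => //; apply: fin_bigcap_measurable => // k _.
      by apply: mf => //; have [] := BP k.
    by apply/seteqP; split=> x [Dx Ex]; split=> // k _; [split=> //; exact: Ex|case: (Ex k)].
  rewrite -integral_indic_set//.
  apply: eq_integral => x; rewrite inE => Dx; congr (_%:E).
  rewrite indicE; case: (boolP (x \in _)) => [|xE].
    rewrite inE => -[_ Ex]; rewrite big1// => k _; have [_ ->] := BP k.
    by rewrite indicE mem_set//; exact: Ex.
  have [k Bk] : exists k, ~ B k (f k x).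
    by apply/existsNP => BE; move/negP: xE; apply; rewrite inE; split => // k _; exact: BE.
  by rewrite (bigD1 k)//=; have [_ ->] := BP k; rewrite indicE memNset// mul0r.
pose h x := \prod_(k < N | k != a) V k (f k x).
(* Finiteness of all the integrals makes the product of the others a real constant. *)
pose c := fine (\prod_(k < N | k != a) \int[mu]_(x in D) (V k (f k x))%:E)%E.
have cE : (\prod_(k < N | k != a) \int[mu]_(x in D) (V k (f k x))%:E = c%:E)%E.
  rewrite fineK//; apply: (big_ind (fun z => z \is a fin_num)) => //.
    by move=> x y xf yf; rewrite fin_numM.
  by move=> k _; rewrite ge0_fin_numE// integral_ge0// => x _; rewrite lee_fin.
rewrite (bigD1 a)//= cE muleC.
under eq_integral do rewrite (bigD1 a)//= mulrC -/(h _).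
apply: (@integral_mul_comp _ _ _ mu D mD h c (f a)) => //.
- have -> : h = fun x => \prod_(k <- [seq k <- index_enum 'I_N | k != a]) V k (f k x).
    by apply/funext => x; rewrite /h big_filter.
  by apply: measurable_prod => k _; exact: measurableT_comp.
- by move=> x; exact: prodr_ge0.
(* Once the factor at [a] is an indicator, only the indices in [s] remain general and the induction
   hypothesis applies. *)
move=> B mB; pose V' k := if k == a then \1_B else V k.
have V'a : V' a = \1_B by rewrite /V' eqxx.
have V'k k : k != a -> V' k = V k by rewrite /V' => /negbTE ->.
have := ih V'; rewrite (bigD1 a)//= V'a.
rewrite (eq_bigr (fun k => \int[mu]_(x in D) (V k (f k x))%:E)%E); last first.
  by move=> k ka; rewrite V'k.
rewrite cE muleC => <-.
- apply: eq_integral => x _; congr (_%:E).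
  rewrite (bigD1 a)//= V'a mulrC; congr (_ * _).
  by apply: eq_bigr => k ka; rewrite V'k.
- by move=> k; rewrite /V'; case: ifP.
- by move=> k y; rewrite /V'; case: ifP => // _; rewrite indicE.
- move=> k; rewrite /V'; case: ifP => // _.
  rewrite integral_indic_comp//; apply: (@le_lt_trans _ _ 1%E); last exact: ltry.
  by rewrite -muD le_measure ?inE//; exact: mf.
- move=> k ks; rewrite /V'; case: ifPn => [_|ka]; first by exists B.
  by apply: Vs; rewrite inE negb_or ka.
Qed.

End independence_product.

(** * Pairings with bounded functions of independent variables *)

Section bounded_integrals.
Context d (T : measurableType d) (R : realType).
Variables (mu : {measure set T -> \bar R}) (D : set T).
Hypotheses (mD : measurable D) (muD : mu D = 1%E).

Lemma bounded_on_le (g : T -> R) m :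
  (forall x, D x -> `|g x| <= m) -> [bounded g x | x in D].
Proof.
move=> gm; exists m; split; first exact: num_real.
by move=> y my x Dx; exact: le_trans (gm x Dx) (ltW my).
Qed.

Lemma integrable_bounded_fun (g : T -> R) m : measurable_fun D g ->
  (forall x, D x -> `|g x| <= m) -> mu.-integrable D (EFin \o g).
Proof.
move=> mg gm; apply: measurable_bounded_integrable => //.
  by rewrite muD ltry.
exact: bounded_on_le gm.
Qed.

Lemma integrable_mul_bounded (u g : T -> R) m : measurable_fun D g ->
  (forall x, D x -> `|g x| <= m) -> mu.-integrable D (EFin \o u) ->
  mu.-integrable D (EFin \o (fun x => u x * g x)).
Proof.
move=> mg gm iu; have := integrableMr mD mg (bounded_on_le gm) iu.
by apply: eq_integrable => // x _; rewrite /= mulrC EFinM.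
Qed.

Lemma integrable_scale (u : T -> R) a : mu.-integrable D (EFin \o u) ->
  mu.-integrable D (EFin \o (fun x => a * u x)).
Proof. by move=> iu; exact: (integrableZl mD a iu). Qed.

Lemma integrable_sum_fun (I : finType) (u : I -> T -> R) :
  (forall i, mu.-integrable D (EFin \o u i)) ->
  mu.-integrable D (EFin \o (fun x => \sum_i u i x)).
Proof.
move=> iu; have := @integrable_sum _ _ _ mu D mD _ (index_enum I) xpredT
  (fun i => EFin \o u i) (fun i _ => iu i).
by apply: eq_integrable => // x _; rewrite /= sumEFin.
Qed.

Lemma EFin_Rintegral (u : T -> R) : mu.-integrable D (EFin \o u) ->
  (\int[mu]_(x in D) u x)%:E = (\int[mu]_(x in D) (u x)%:E)%E.
Proof. by move=> iu; rewrite fineK//; exact: integrable_fin_num. Qed.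

Lemma Rintegral_sum (I : finType) (u : I -> T -> R) :
  (forall i, mu.-integrable D (EFin \o u i)) ->
  \int[mu]_(x in D) (\sum_i u i x) = \sum_i \int[mu]_(x in D) u i x.
Proof.
move=> iu; apply: EFin_inj; rewrite EFin_Rintegral; last exact: integrable_sum_fun.
under eq_integral do rewrite -sumEFin.
rewrite (@integral_sum _ _ _ mu D mD _ (fun i => EFin \o u i) iu) -sumEFin.
by apply: eq_bigr => i _; rewrite EFin_Rintegral.
Qed.

Lemma Rintegral_mul_independent_ge0 N (f : 'I_N -> T -> R) (j k : 'I_N)
    (U V : R -> R) : j != k ->
  (forall i, measurable_fun D (f i)) -> independent_on mu D f ->
  measurable_fun setT U -> measurable_fun setT V ->
  (forall y, 0 <= U y) -> (forall y, 0 <= V y) ->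
  mu.-integrable D (EFin \o (U \o f j)) -> mu.-integrable D (EFin \o (V \o f k)) ->
  \int[mu]_(x in D) (U (f j x) * V (f k x))
    = \int[mu]_(x in D) U (f j x) * \int[mu]_(x in D) V (f k x).
Proof.
move=> jk mf indep mU mV U0 V0 iU iV.
(* The other factors are 1, with integral 1 because mu D = 1. *)
pose W i := if i == j then U else if i == k then V else cst 1.
have Wj : W j = U by rewrite /W eqxx.
have Wk : W k = V by rewrite /W eqxx eq_sym (negbTE jk).
have Wi i : i != j -> i != k -> W i = cst 1.
  by rewrite /W => /negbTE -> /negbTE ->.
have int1 : (\int[mu]_(x in D) (1%R : R)%:E = 1)%E.
  by rewrite integral_cst// muD mule1.
have := integral_prod_independent mD muD (W := W) mf indep.
rewrite (bigD1 j)//= (bigD1 k) 1?eq_sym//= Wj Wk big1; last first.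
  by move=> i /andP[ij ik]; rewrite Wi.
rewrite mule1 => H; rewrite /Rintegral -fineM; first last.
- exact: (integrable_fin_num mD iV).
- exact: (integrable_fin_num mD iU).
rewrite -H.
- congr fine; apply: eq_integral => x _; congr (_%:E).
  rewrite (bigD1 j)//= (bigD1 k) 1?eq_sym//= Wj Wk big1 ?mulr1//.
  by move=> i /andP[ij ik]; rewrite Wi.
- by move=> i; rewrite /W; case: ifP => // _; case: ifP.
- by move=> i y; rewrite /W; case: ifP => // _; case: ifP.
- move=> i; rewrite /W; case: ifP => [/eqP->|_]; first exact: integrable_lty iU.
  case: ifP => [/eqP->|_]; first exact: integrable_lty iV.
  by rewrite int1 ltry.
Qed.

(** Kills the off-diagonal pairings. The product rule is available for nonnegative factors, so [G]
    is shifted by its bound and [f j] is split into positive and negative parts. *)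
Lemma Rintegral_mean_zero_mul N (f : 'I_N -> T -> R) (j k : 'I_N)
    (G : R -> R) m : j != k ->
  (forall i, measurable_fun D (f i)) -> independent_on mu D f ->
  measurable_fun setT G -> (forall y, `|G y| <= m) ->
  mu.-integrable D (EFin \o f j) -> \int[mu]_(x in D) f j x = 0 ->
  \int[mu]_(x in D) (f j x * G (f k x)) = 0.
Proof.
move=> jk mf indep mG Gm ifj f0.
pose V y := G y + m.
have mV : measurable_fun setT V by exact: measurable_funD.
have V0 y : 0 <= V y.
  by rewrite -lerBlDr sub0r; have := Gm y; rewrite ler_norml => /andP[].
have V2 y : `|V y| <= m + m.
  rewrite (le_trans (ler_normD _ _))// lerD// ger0_norm//.
  exact: le_trans (normr_ge0 _) (Gm 0).
have mVf : measurable_fun D (V \o f k) by exact: measurableT_comp.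
pose Up (y : R) := Num.max y 0; pose Um (y : R) := Num.max (- y) 0.
have mUp : measurable_fun setT Up by apply: measurable_maxr.
have mUm : measurable_fun setT Um.
  by apply: measurable_maxr => //; exact: measurable_funN.
have Up0 y : 0 <= Up y by rewrite /Up le_max lexx orbT.
have Um0 y : 0 <= Um y by rewrite /Um le_max lexx orbT.
have UpUm y : y = Up y - Um y.
  rewrite /Up /Um; case/orP: (le_total 0 y) => y0.
    by rewrite max_l// max_r ?oppr_le0// subr0.
  by rewrite max_r// max_l ?oppr_ge0// sub0r opprK.
have leUp y : `|Up y| <= `|y|.
  by rewrite ger0_norm// /Up ge_max ler_norm normr_ge0.
have leUm y : `|Um y| <= `|y|.
  by rewrite ger0_norm// /Um ge_max -normrN ler_norm normr_ge0.
have iUp : mu.-integrable D (EFin \o (Up \o f j)).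
  apply: le_integrable ifj => //; first by apply/measurable_EFinP; exact: measurableT_comp.
  by move=> x _ /=; rewrite lee_fin.
have iUm : mu.-integrable D (EFin \o (Um \o f j)).
  apply: le_integrable ifj => //; first by apply/measurable_EFinP; exact: measurableT_comp.
  by move=> x _ /=; rewrite lee_fin.
have iV : mu.-integrable D (EFin \o (V \o f k)).
  by apply: (integrable_bounded_fun (m := m + m)) => // x _; exact: V2.
have fV : \int[mu]_(x in D) (f j x * V (f k x)) = 0.
  transitivity (\int[mu]_(x in D) (Up (f j x) * V (f k x) - Um (f j x) * V (f k x))).
    by apply: eq_Rintegral => x _; rewrite -mulrBl -UpUm.
  rewrite RintegralB//; first last.
  - by apply: (@integrable_mul_bounded _ (V \o f k) (m + m)) => // x _; exact: V2.
  - by apply: (@integrable_mul_bounded _ (V \o f k) (m + m)) => // x _; exact: V2.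
  rewrite !(Rintegral_mul_independent_ge0 jk mf indep)// -mulrBl -RintegralB//.
  rewrite (_ : \int[mu]_(x in D) _ = 0) ?mul0r// -[RHS]f0.
  by apply: eq_Rintegral => x _; rewrite -UpUm.
transitivity (\int[mu]_(x in D) (f j x * V (f k x) - m * f j x)).
  by apply: eq_Rintegral => x _; rewrite /V; ring.
rewrite RintegralB//; first last.
- exact: integrable_scale.
- by apply: (@integrable_mul_bounded _ (V \o f k) (m + m)) => // x _; exact: V2.
by rewrite RintegralZl// f0 fV mulr0 subr0.
Qed.

End bounded_integrals.

(** * Orlicz functions *)

Section orlicz_theory.
Context (R : realType) (Phi : R -> R).
Hypothesis oPhi : orlicz_function Phi.

Lemma orlicz_le u v : 0 <= u -> u <= v -> Phi u <= Phi v.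
Proof.
move=> u0; rewrite le_eqVlt => /predU1P[->//|uv].
by apply/ltW/(orlicz_increasing oPhi) => //; rewrite in_itv/= andbT ?(le_trans u0 (ltW uv)).
Qed.

Lemma orlicz_scale_le a u : 0 <= a <= 1 -> 0 <= u -> Phi (a * u) <= a * Phi u.
Proof.
move=> /andP[a0 a1] u0.
have := orlicz_convex oPhi (Itv01 a0 a1) (x := u) (y := 0).
rewrite !inE/= !in_itv/= u0 lexx => /(_ isT isT).
rewrite convRE/= (orlicz0 oPhi) mulr0 addr0; apply: le_trans.
suff -> : a * u = conv (Itv01 a0 a1) (u : convex_lmodType R) 0 by [].
by rewrite -[LHS]addr0 -[X in _ + X](mulr0 (unstable.onem a)).
Qed.

Lemma orlicz_slope_le s t : 0 < s -> s <= t -> Phi s / s <= Phi t / t.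
Proof.
move=> s0 st; have t0 := lt_le_trans s0 st.
have := @orlicz_scale_le (s / t) t; rewrite divfK ?gt_eqF//.
rewrite ler_pdivrMr// mul1r st (divr_ge0 (ltW s0) (ltW t0)) => /(_ isT (ltW t0)) h.
by rewrite ler_pdivrMr// (_ : Phi t / t * s = s / t * Phi t)//; ring.
Qed.

Lemma orlicz_ge_id t : 1 <= t -> t <= Phi t.
Proof.
move=> t1; have := orlicz_slope_le ltr01 t1.
by rewrite (orlicz1 oPhi) divr1 ler_pdivlMr ?mul1r// (lt_le_trans ltr01).
Qed.

Lemma orlicz_ge_id_sub1 t : 0 <= t -> t <= 1 + Phi t.
Proof.
move=> t0; have P0 := orlicz_ge0 oPhi t0.
have [t1|/ltW t1] := leP t 1; first by rewrite (le_trans t1)// lerDl.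
by rewrite (le_trans (orlicz_ge_id t1))// lerDr.
Qed.

(** [Phi] is known to be monotone only on nonnegative reals; clamping its argument at 0 makes it
    monotone on the whole line. *)
Lemma measurable_orlicz_norm : measurable_fun setT (fun y : R => Phi `|y|).
Proof.
have -> : (fun y : R => Phi `|y|) = (fun y => Phi (Num.max y 0)) \o (fun y : R => `|y|).
  by apply/funext => y /=; rewrite max_l.
apply: measurableT_comp; last exact: normr_measurable.
apply: nondecreasing_measurable => // x y xy; apply: orlicz_le.
  by rewrite le_max lexx orbT.
by rewrite ge_max !le_max xy lexx orbT.
Qed.

End orlicz_theory.

Section orlicz_integrals.
Context d (T : measurableType d) (R : realType).
Variables (mu : {measure set T -> \bar R}) (D : set T) (Phi : R -> R).
Hypotheses (mD : measurable D) (muD : mu D = 1%E) (oPhi : orlicz_function Phi).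

Lemma measurable_orlicz_comp (h : T -> R) l : 0 < l -> measurable_fun D h ->
  measurable_fun D (fun x => Phi (`|h x| / l)).
Proof.
move=> l0 mh.
have -> : (fun x => Phi (`|h x| / l)) = (fun y : R => Phi `|y|) \o (fun x => h x * l^-1).
  by apply/funext => x /=; rewrite normrM (ger0_norm (x := l^-1))// invr_ge0 ltW.
apply: measurableT_comp; first exact: measurable_orlicz_norm.
exact: measurable_funM.
Qed.

Lemma orlicz_comp_ge0 (h : T -> R) l x : 0 < l -> 0 <= Phi (`|h x| / l).
Proof. by move=> l0; rewrite (orlicz_ge0 oPhi)// divr_ge0// ltW. Qed.

Lemma integrable_orlicz_comp (h : T -> R) l : 0 < l -> measurable_fun D h ->
  (\int[mu]_(x in D) (Phi (`|h x| / l))%:E <= 1)%E ->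
  mu.-integrable D (EFin \o (fun x => Phi (`|h x| / l))).
Proof.
move=> l0 mh hl; apply/integrableP; split.
  by apply/measurable_EFinP; exact: measurable_orlicz_comp.
rewrite (le_lt_trans _ (ltry 1))//; apply: le_trans hl.
rewrite le_eqVlt; apply/orP; left; apply/eqP/eq_integral => x _ /=.
by rewrite ger0_norm// orlicz_comp_ge0.
Qed.

(** Since t <= 1 + Phi t, the Orlicz space lies in L_1 over a set of measure 1. *)
Lemma integrable_of_orlicz (h : T -> R) l : 0 < l -> measurable_fun D h ->
  (\int[mu]_(x in D) (Phi (`|h x| / l))%:E <= 1)%E ->
  mu.-integrable D (EFin \o h).
Proof.
move=> l0 mh hl.
have i1 : mu.-integrable D (EFin \o (fun x => l * (1 + Phi (`|h x| / l)))).
  apply: integrable_scale => //.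
  have ic : mu.-integrable D (EFin \o cst (1 : R)).
    by apply: (integrable_bounded_fun mD muD (m := 1)) => // x _; rewrite /= normr1.
  by have := integrableD mD ic (integrable_orlicz_comp l0 mh hl); apply: eq_integrable.
apply: le_integrable i1 => //; first exact/measurable_EFinP.
move=> x _ /=; rewrite lee_fin.
have := orlicz_ge_id_sub1 oPhi (t := `|h x| / l).
rewrite (divr_ge0 (normr_ge0 _) (ltW l0)) => /(_ isT).
rewrite ler_pdivrMr// => /le_trans; apply.
by rewrite mulrC ler_norm.
Qed.

Lemma luxemburg_lt_admissible (h : T -> R) (r : R) :
  (luxemburg mu D Phi h < r%:E)%E ->
  exists l, [/\ 0 < l, l < r & (\int[mu]_(x in D) (Phi (`|h x| / l))%:E <= 1)%E].
Proof.
move=> /ereal_inf_lt[_ [l [l0 hl] <-]]; rewrite lte_fin => lr.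
by exists l; split.
Qed.

Lemma orlicz_space_integrable (h : T -> R) : orlicz_space mu D Phi h ->
  mu.-integrable D (EFin \o h).
Proof.
move=> [mh hfin].
have [r hr] : exists r : R, (luxemburg mu D Phi h < r%:E)%E.
  move: hfin; case: (luxemburg _ _ _ _) => [s|//|] _.
    by exists (s + 1); rewrite lte_fin ltrDl.
  by exists 0; rewrite ltNyr.
have [l [l0 _ hl]] := luxemburg_lt_admissible hr.
exact: integrable_of_orlicz l0 mh hl.
Qed.

(* If the Luxemburg norm is at least 1, then the modular at scale 1/2 exceeds
   1, already after truncating the function. *)
Lemma truncated_modular_gt1 (h : T -> R) : measurable_fun D h ->
  (1 <= luxemburg mu D Phi h)%E ->
  exists n : nat, (1 < \int[mu]_(x in D)
    (Phi (2 * `|h x|) * \1_(`[- n%:R, n%:R]) (h x))%:E)%E.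
Proof.
move=> mh h1; apply/not_existsP => small.
have mPh : measurable_fun D (fun x => Phi (2 * `|h x|)).
  have := measurable_orlicz_comp (l := 2^-1) _ mh.
  rewrite invr_gt0 ltr0n => /(_ isT).
  by under eq_fun do rewrite invrK mulrC.
have mind (n : nat) : measurable_fun D (fun x => \1_(`[- n%:R, n%:R]) (h x) : R).
  by apply: (measurableT_comp (f := \1_(`[- n%:R, n%:R]) : R -> R)).
have P0 x : 0 <= Phi (2 * `|h x|) by rewrite (orlicz_ge0 oPhi)// mulr_ge0.
pose g (n : nat) x := (Phi (2 * `|h x|) * \1_(`[- n%:R, n%:R]) (h x))%:E.
have gcvg x : g n x @[n --> \oo] --> (Phi (2 * `|h x|))%:E.
  apply: cvg_near_cst; exists (Num.truncn `|h x|).+1 => // n /= hn.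
  rewrite /g indicE mem_set ?mulr1//= in_itv/= -ler_norml.
  have /andP[_ /ltW] := truncn_itv (normr_ge0 (h x)).
  by move=> /le_trans; apply; rewrite ler_nat.
have : (\int[mu]_(x in D) limn (g^~ x) <= 1)%E.
  have mg n : measurable_fun D (g n).
    by apply/measurable_EFinP; apply: measurable_funM => //; exact: mind.
  have g0 n x : D x -> (0 <= g n x)%E.
    by rewrite lee_fin mulr_ge0// indicE.
  have gnd x : D x -> {homo g^~ x : m n / (m <= n)%N >-> (m <= n)%E}.
    move=> _ m n mn; rewrite lee_fin ler_wpM2l// !indicE ler_nat.
    have [|//] := boolP (_ \in `[- m%:R, m%:R]%classic).
    rewrite !inE/= !in_itv/= -!ler_norml => /le_trans xm.
    by rewrite mem_set//= in_itv/= -ler_norml xm// ler_nat.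
  have lim := @cvg_monotone_convergence _ _ _ mu D mD g mg g0 gnd.
  rewrite -(cvg_lim _ lim)//; apply: lime_le; first by apply/cvg_ex; eexists; exact: lim.
  by apply: nearW => n; rewrite leNgt; apply/negP => /small.
rewrite leNgt; case/negP.
have : ~ (\int[mu]_(x in D) (Phi (`|h x| / 2^-1))%:E <= 1)%E.
  move=> half; have : (luxemburg mu D Phi h <= (2^-1)%:E)%E.
    by apply: ereal_inf_lbound; exists 2^-1 => //; split => //; rewrite invr_gt0.
  by move=> /(le_trans h1); rewrite lee_fin; lra.
move=> /negP; rewrite -ltNge => /lt_le_trans; apply.
rewrite le_eqVlt; apply/orP; left; apply/eqP/eq_integral => x _.
by rewrite (cvg_lim _ (gcvg x))// invrK mulrC.
Qed.

End orlicz_integrals.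

(** * Exponential estimates for independent sums *)

Section gauge_integrals.
Context d (T : measurableType d) (R : realType).
Variables (mu : {measure set T -> \bar R}) (D : set T) (C : R) (M : R -> R).
Hypotheses (mD : measurable D) (muD : mu D = 1%E) (C1 : 1 <= C) (gM : gauge C M).

Lemma measurable_gauge : measurable_fun setT M.
Proof. exact: nondecreasing_measurable (gauge_homo gM). Qed.

Lemma measurable_gauge_norm_comp (h : T -> R) : measurable_fun D h ->
  measurable_fun D (fun x => M `|h x|).
Proof.
move=> mh; apply: (measurableT_comp measurable_gauge).
by apply: measurableT_comp => //; exact: normr_measurable.
Qed.

Lemma measurable_weight : measurable_fun setT (weight M).
Proof.
rewrite /weight; apply: measurable_fun_ifT.
- by apply: measurable_fun_ler => //; exact: normr_measurable.
- by apply: measurableT_comp => //; exact: measurable_funM.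
- by apply: (measurableT_comp measurable_gauge); exact: normr_measurable.
Qed.

Lemma integrable_gauge_norm (h : T -> R) m : measurable_fun D h ->
  (forall x, D x -> `|h x| <= m) -> mu.-integrable D (EFin \o (fun x => M `|h x|)).
Proof.
move=> mh hm; apply: (integrable_bounded_fun mD muD (m := M m)).
  exact: measurable_gauge_norm_comp.
move=> x Dx; rewrite ger0_norm ?(ltW (gauge_gt0 gM _))//.
by apply: (gauge_homo gM); exact: hm.
Qed.

Lemma weight_le_gauge_bound x m : 1 <= m -> `|x| <= m ->
  `|weight M x| <= Num.max (expR (ln (M 1))) (M m).
Proof.
move=> m1 xm; rewrite ger0_norm ?(ltW (weight_gt0 gM _))// /weight le_max.
have b0 : 0 <= ln (M 1) by rewrite ln_ge0// (gauge_ge1 gM).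
case: ifP => [x1|_]; last by rewrite (gauge_homo gM xm) orbT.
by rewrite ler_expR ler_piMr// (le_trans (ler_norm _)).
Qed.

Section independent_sum.
Variables (N : nat) (f : 'I_N -> T -> R) (G : 'I_N -> R -> R) (m : 'I_N -> R).
Variable C0 : R.
Hypotheses (C00 : 0 <= C0) (mf : forall k, measurable_fun D (f k)) (indep : independent_on mu D f).
Hypotheses (mG : forall k, measurable_fun setT (G k))
  (Gm : forall k y, `|G k y| <= m k)
  (G0 : forall k, \int[mu]_(x in D) G k (f k x) = 0)
  (MG : forall k, \int[mu]_(x in D) M `|G k (f k x)| <= C0).

Let mGf k : measurable_fun D (fun x => G k (f k x)).
Proof. exact: measurableT_comp. Qed.

Let iGf k : mu.-integrable D (EFin \o (fun x => G k (f k x))).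
Proof. by apply: (integrable_bounded_fun mD muD (m := m k)). Qed.

Let iMGf k : mu.-integrable D (EFin \o (fun x => M `|G k (f k x)|)).
Proof. by apply: (integrable_gauge_norm (m := m k)). Qed.

Lemma integrable_weight k (a : R) :
  mu.-integrable D (EFin \o (fun x => weight M (a * G k (f k x)))).
Proof.
pose m' := Num.max 1 (`|a| * m k).
apply: (integrable_bounded_fun mD muD (m := Num.max (expR (ln (M 1))) (M m'))).
  by apply: (measurableT_comp measurable_weight); exact: measurable_funM.
move=> x _; apply: weight_le_gauge_bound; rewrite le_max ?lexx//.
by rewrite normrM ler_wpM2l// orbT.
Qed.

(** The linear term integrates to 0 because [G k (f k)] is centred; 1 + x <= exp x then prepares the
    product over k. *)
Lemma integral_weight_le k (a : R) : `|a| <= 1 ->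
  \int[mu]_(x in D) weight M (a * G k (f k x))
    <= expR (weight_cst C M * C0 * a ^+ 2).
Proof.
move=> a1; set w := weight_cst C M; have w0 : 0 <= w := weight_cst_ge0 C1 gM.
set b := ln (M 1).
have i1 : mu.-integrable D (EFin \o cst (1 : R)).
  by apply: (integrable_bounded_fun mD muD (m := 1)) => // x _; rewrite /= normr1.
have i2 := integrable_scale mD (b * a) (iGf k).
have i3 := integrable_scale mD (w * a ^+ 2) (iMGf k).
have i12 : mu.-integrable D (EFin \o (fun x => 1 + b * a * G k (f k x))).
  by have := integrableD mD i1 i2; apply: eq_integrable.
have i123 : mu.-integrable D (EFin \o
    (fun x => 1 + b * a * G k (f k x) + w * a ^+ 2 * M `|G k (f k x)|)).
  by have := integrableD mD i12 i3; apply: eq_integrable.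
apply: (@le_trans _ _ (\int[mu]_(x in D)
    (1 + b * a * G k (f k x) + w * a ^+ 2 * M `|G k (f k x)|))).
  apply: le_Rintegral => //; first exact: integrable_weight.
  by move=> x _; exact: weight_scale_le.
rewrite RintegralD// RintegralD// RintegralZl// RintegralZl//.
rewrite Rintegral_cst// muD/= G0 mulr0 addr0 mulr1.
apply: le_trans (expR_ge1Dx _); rewrite lerD2l mulrAC ler_wpM2r ?sqr_ge0//.
exact: ler_wpM2l.
Qed.

(** Independence turns the mean of a product of weights into a product of exponentials, whose
    exponents add up to a multiple of the sum of the a k ^+ 2. This is where the l2 norm arises. *)
Lemma integral_gauge_norm_sum_le (a : 'I_N -> R) : \sum_k a k ^+ 2 <= 1 ->
  \int[mu]_(x in D) M `|\sum_k a k * G k (f k x)|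
    <= M 1 * (2 * expR (weight_cst C M * C0)).
Proof.
move=> a1.
have wC0 : 0 <= weight_cst C M * C0.
  by rewrite mulr_ge0// (weight_cst_ge0 C1 gM).
have ak k : `|a k| <= 1.
  rewrite -(ler_pXn2r (n := 2))// ?nnegrE// expr1n real_normK ?num_real//.
  by apply: le_trans a1; rewrite (bigD1 k)//= lerDl sumr_ge0// => i _; exact: sqr_ge0.
(* Free signs of the coefficients, since the products for a and for - a both occur. *)
have prod_bound (c : 'I_N -> R) : (forall k, c k ^+ 2 = a k ^+ 2) ->
    mu.-integrable D (EFin \o (fun x => \prod_k weight M (c k * G k (f k x)))) /\
    \int[mu]_(x in D) \prod_k weight M (c k * G k (f k x))
      <= expR (weight_cst C M * C0).
  move=> ca; have ck k : `|c k| <= 1 by rewrite -sqrtr_sqr ca sqrtr_sqr.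
  have mW k : measurable_fun setT (fun y => weight M (c k * G k y)).
    by apply: (measurableT_comp measurable_weight); exact: measurable_funM.
  have W0 k y : 0 <= weight M (c k * G k y) by exact: ltW (weight_gt0 gM _).
  have iW k := integrable_weight k (c k).
  have prodE := integral_prod_independent mD muD mf indep mW W0
    (fun k => integrable_lty mD (iW k)).
  rewrite (eq_bigr (fun k =>
    (\int[mu]_(x in D) weight M (c k * G k (f k x)))%:E)) in prodE; last first.
    by move=> k _; rewrite EFin_Rintegral.
  rewrite prodEFin in prodE.
  split.
    apply/integrableP; split.
      apply/measurable_EFinP; apply: measurable_prod => k _.
      exact: (measurableT_comp (mW k)).
    apply: (@le_lt_trans _ _ (\int[mu]_(x in D)
        (\prod_k weight M (c k * G k (f k x)))%:E)%E); last by rewrite prodE ltry.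
    rewrite le_eqVlt; apply/orP; left; apply/eqP/eq_integral => x _ /=.
    by rewrite ger0_norm//; exact: prodr_ge0.
  rewrite /Rintegral prodE/=.
  apply: (@le_trans _ _ (\prod_k expR (weight_cst C M * C0 * c k ^+ 2))).
    apply: ler_prod => k _; rewrite integral_weight_le// andbT.
    by apply: Rintegral_ge0 => x _.
  rewrite -expR_sum ler_expR -mulr_sumr.
  under eq_bigr do rewrite ca.
  by rewrite ler_piMr.
have [i1 b1] := prod_bound a (fun=> erefl).
have [i2 b2] := prod_bound (fun k => - a k) (fun k => sqrrN _).
have mg : measurable_fun D (fun x => \sum_k a k * G k (f k x)).
  by apply: measurable_sum => k; exact: measurable_funM.
apply: (@le_trans _ _ (\int[mu]_(x in D) (M 1 *
    (\prod_k weight M (a k * G k (f k x)) + \prod_k weight M (- a k * G k (f k x)))))).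
  apply: le_Rintegral => //.
  - apply: (integrable_gauge_norm (m := \sum_k m k)) => // x _.
    rewrite (le_trans (ler_norm_sum _ _ _))// ler_sum// => k _.
    rewrite normrM (le_trans _ (Gm k (f k x)))// ler_piMl//.
  - apply: integrable_scale => //.
    by have := integrableD mD i1 i2; apply: eq_integrable.
  - move=> x _; have := gauge_norm_sum_le gM (index_enum 'I_N)
      (fun k => a k * G k (f k x)) 0.
    rewrite add0r mulr0 oppr0 expR0 !mul1r.
    by under [X in _ <= _ * (_ + X)]eq_bigr do rewrite -mulNr.
rewrite RintegralZl//; last by have := integrableD mD i1 i2; apply: eq_integrable.
rewrite ler_pM2l ?(gauge_gt0 gM)// RintegralD// mulr_natl mulr2n.
exact: lerD.
Qed.

End independent_sum.

End gauge_integrals.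

(* When M is a multiple of the conjugate Phi', the last two fields are Young's
   inequality and Phi' (Phi t / t) <= Phi t. *)
Record young_gauge {R : realType} (Phi : R -> R) (C eps : R) (M : R -> R) : Prop :=
  YoungGauge {
  young_gauge_gauge : gauge C M ;
  young_gaugeM : forall u v, 0 <= u -> 0 <= v -> u * v <= C * (Phi u + M v) ;
  young_gauge_slope : forall t, 0 <= t -> M (eps * (Phi t / t)) <= C * (1 + Phi t) }.

(** * The bounded centred test function of one variable *)

Section witness.
Context d (T : measurableType d) (R : realType).
Variables (mu : {measure set T -> \bar R}) (D : set T).
Variables (Phi M : R -> R) (C eps : R).
Hypotheses (mD : measurable D) (muD : mu D = 1%E) (oPhi : orlicz_function Phi).
Hypotheses (C1 : 1 <= C) (eps0 : 0 < eps) (yM : young_gauge Phi C eps M).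
Let gM := young_gauge_gauge yM.

(** Clamping at 0 makes the secant slope nondecreasing on the whole line, hence measurable; for t <=
    0 it is 0 / 0 = 0. *)
Let slope (t : R) := Phi (Num.max t 0) / Num.max t 0.

Let slope_ge0 t : 0 <= slope t.
Proof.
have t0 : 0 <= Num.max t 0 by rewrite le_max lexx orbT.
by rewrite divr_ge0// (orlicz_ge0 oPhi).
Qed.

Let slope_homo : {homo slope : s t / s <= t}.
Proof.
move=> s t st; have [s0|s0] := leP s 0.
  by rewrite {1}/slope max_r// (orlicz0 oPhi) mul0r.
have t0 := lt_le_trans s0 st.
by rewrite /slope (max_l (ltW s0)) (max_l (ltW t0)) orlicz_slope_le.
Qed.

(** The factor 2 matches scale 1/2, at which a norm of at least 1 forces the modular above 1. *)
Let odd_slope (y : R) := slope (2 * y) - slope (- (2 * y)).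

Let slope_le0 t : t <= 0 -> slope t = 0.
Proof. by move=> t0; rewrite /slope max_r// (orlicz0 oPhi) mul0r. Qed.

Let norm_odd_slope y : `|odd_slope y| = Phi (2 * `|y|) / (2 * `|y|).
Proof.
rewrite /odd_slope; case/orP: (le_total 0 y) => y0.
  rewrite (slope_le0 (t := - _)) ?oppr_le0 ?mulr_ge0// subr0 ger0_norm//.
  by rewrite /slope max_l ?mulr_ge0// (ger0_norm y0).
rewrite (slope_le0 (t := 2 * y)) ?mulr_ge0_le0// sub0r normrN ger0_norm//.
by rewrite /slope max_l ?oppr_ge0 ?mulr_ge0_le0// (ler0_norm y0) mulrN.
Qed.

Let mul_odd_slope y : y * odd_slope y = Phi (2 * `|y|) / 2.
Proof.
have [->|y0] := eqVneq y 0; first by rewrite mul0r normr0 mulr0 (orlicz0 oPhi) mul0r.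
have y20 : 2 * `|y| != 0 by rewrite mulf_neq0// normr_eq0.
have -> : y * odd_slope y = `|y| * `|odd_slope y|.
  rewrite /odd_slope; case/orP: (le_total 0 y) => y0'.
    by rewrite (slope_le0 (t := - _)) ?oppr_le0 ?mulr_ge0// subr0 !ger0_norm.
  rewrite (slope_le0 (t := 2 * y)) ?mulr_ge0_le0// sub0r normrN.
  by rewrite (ler0_norm y0') ger0_norm// mulrN mulNr.
rewrite norm_odd_slope; field; by rewrite normr_eq0.
Qed.

Let measurable_slope : measurable_fun setT slope.
Proof. exact: nondecreasing_measurable. Qed.

Let measurable_odd_slope : measurable_fun setT odd_slope.
Proof.
apply: measurable_funB; apply: (measurableT_comp measurable_slope).
  exact: measurable_funM.
by apply: measurable_funN; exact: measurable_funM.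
Qed.

(** [A] bounds the M-mass before centring, C A bounds the mean to be removed, and M (C A) is the
    price of removing it. *)
Let A := M 1 + 2 * C ^+ 2.
Definition witness_cst := A * M (C * A).

Lemma witness_cst_ge0 : 0 <= witness_cst.
Proof.
have M1 := gauge_gt0 gM 1; have M2 := gauge_gt0 gM (C * A).
by rewrite mulr_ge0 ?(ltW M2)// addr_ge0 ?(ltW M1)// mulr_ge0// sqr_ge0.
Qed.

(* For f truncated, f * G (f) is proportional to Phi (2 |f|), while the mass of
   M (G (f)) stays bounded by young_gauge_slope. *)
Lemma centred_witness (f : T -> R) : measurable_fun D f ->
  mu.-integrable D (EFin \o f) -> \int[mu]_(x in D) f x = 0 ->
  (1 <= luxemburg mu D Phi f)%E ->
  exists G : R -> R, exists m : R,
    [/\ measurable_fun setT G, forall y, `|G y| <= m,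
        \int[mu]_(x in D) (f x * G (f x)) = eps / 2,
        \int[mu]_(x in D) G (f x) = 0 &
        \int[mu]_(x in D) M `|G (f x)| <= witness_cst].
Proof.
move=> mf iff f0 f1.
have [n n1] := truncated_modular_gt1 mD oPhi mf f1.
pose ind (y : R) : R := \1_(`[- n%:R, n%:R]) y.
have mind : measurable_fun setT ind by exact: measurable_indic.
have indP y : (ind y = 1 /\ `|y| <= n%:R) \/ ind y = 0.
  rewrite /ind indicE; case: (boolP (y \in _)) => [|_]; last by right.
  by rewrite inE/= in_itv/= -ler_norml; left.
have ind0 y : 0 <= ind y by rewrite /ind indicE.
pose q y := Phi (2 * `|y|) * ind y.
have P0 y : 0 <= Phi (2 * `|y|) by rewrite (orlicz_ge0 oPhi)// mulr_ge0.
have q0 y : 0 <= q y by case: (indP y) => [[]|]; rewrite /q => -> *; rewrite ?mulr1 ?mulr0.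
have qn y : `|q y| <= Phi (2 * n%:R).
  have Pn : 0 <= Phi (2 * n%:R) by rewrite (orlicz_ge0 oPhi)// mulr_ge0.
  rewrite ger0_norm//; case: (indP y) => [[iy yn]|iy]; rewrite /q iy ?mulr1 ?mulr0//.
  by rewrite (orlicz_le oPhi) ?mulr_ge0// ler_wpM2l.
have mq : measurable_fun setT q.
  apply: measurable_funM => //.
  have -> : (fun y : R => Phi (2 * `|y|)) = (fun y : R => Phi `|y|) \o ( *%R 2).
    by apply/funext => y /=; rewrite normrM (ger0_norm (x := 2)).
  by apply: measurableT_comp; [exact: measurable_orlicz_norm|exact: measurable_funM].
have iq : mu.-integrable D (EFin \o (fun x => q (f x))).
  by apply: (integrable_bounded_fun mD muD (m := Phi (2 * n%:R))) => //; exact: measurableT_comp.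
set J := \int[mu]_(x in D) q (f x).
have J1 : 1 < J by rewrite -lte_fin EFin_Rintegral.
have J0 : 0 < J := lt_trans ltr01 J1.
(* Since y * odd_slope y = Phi (2 |y|) / 2, dividing by J normalizes the pairing with f to eps /
   2. *)
pose G0 y := eps / J * (odd_slope y * ind y).
have mG0 : measurable_fun setT G0.
  by apply: measurable_funM => //; exact: measurable_funM.
have G0n y : `|G0 y| = J^-1 * (eps * (Phi (2 * `|y|) / (2 * `|y|)) * ind y).
  rewrite /G0 !normrM norm_odd_slope (gtr0_norm eps0) (gtr0_norm (x := J^-1)) ?invr_gt0//.
  by rewrite (ger0_norm (ind0 y)); ring.
pose m := J^-1 * (eps * slope (2 * n%:R)).
have G0m y : `|G0 y| <= m.
  rewrite G0n /m ler_wpM2l ?invr_ge0 ?(ltW J0)//.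
  case: (indP y) => [[-> yn]|->]; rewrite ?mulr1 ?mulr0; last first.
    by rewrite mulr_ge0// ltW.
  rewrite ler_wpM2l ?(ltW eps0)// -norm_odd_slope norm_odd_slope.
  have -> : Phi (2 * `|y|) / (2 * `|y|) = slope (2 * `|y|).
    by rewrite /slope max_l// mulr_ge0.
  by apply: slope_homo; rewrite ler_wpM2l.
have M1 := gauge_gt0 gM 1.
have C0 : 0 < C := lt_le_trans ltr01 C1.
(* Where the argument exceeds 1, [gauge_quad] with a = 1 / J gives a factor J^-2 <= J^-1. This
   suffices, as 1 + q integrates to 1 + J <= 2 J. *)
have MG0 y : M `|G0 y| <= M 1 + C ^+ 2 / J * (1 + q y).
  rewrite G0n; set u := eps * _ * _.
  have u0 : 0 <= u.
    by rewrite /u -norm_odd_slope mulr_ge0// mulr_ge0// ltW.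
  have Mu : M u <= C * (1 + q y).
    rewrite /u /q; case: (indP y) => [[-> _]|->]; rewrite ?mulr1 ?mulr0.
      by apply: (young_gauge_slope yM); rewrite mulr_ge0.
    (* Off the truncation window u = 0, which is the slope bound at t = 0, where Phi 0 / 0 = 0. *)
    have := young_gauge_slope yM (lexx 0).
    by rewrite (orlicz0 oPhi) mul0r mulr0.
  have qC : 0 <= C ^+ 2 / J * (1 + q y).
    by rewrite mulr_ge0 ?addr_ge0// divr_ge0 ?sqr_ge0// ltW.
  have [Ju|/ltW Ju] := leP 1 (J^-1 * u); last first.
    by rewrite (le_trans (gauge_homo gM Ju))// lerDl.
  have Jle : J^-1 <= 1 by rewrite invf_le1// ltW.
  have := gauge_quad gM (a := J^-1) (u := u).
  rewrite invr_gt0 J0 Jle => /(_ isT Ju) h.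
  rewrite (le_trans h)// (@le_trans _ _ (C ^+ 2 / J * (1 + q y)))//; last by rewrite lerDr ltW.
  have -> : C ^+ 2 / J * (1 + q y) = C * J^-1 * (C * (1 + q y)) by ring.
  apply: ler_pM => //.
  - by rewrite mulr_ge0 ?sqr_ge0// ltW.
  - exact: ltW (gauge_gt0 gM _).
  - rewrite ler_wpM2l ?(ltW C0)// expr2 ler_piMl// invr_ge0 ltW//.
have mG0f : measurable_fun D (fun x => G0 (f x)) by exact: measurableT_comp.
have iG0 : mu.-integrable D (EFin \o (fun x => G0 (f x))).
  by apply: (integrable_bounded_fun mD muD (m := m)).
have iMG0 : mu.-integrable D (EFin \o (fun x => M `|G0 (f x)|)).
  by apply: (integrable_gauge_norm mD muD gM (m := m)).
have i1 : mu.-integrable D (EFin \o cst (1 : R)).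
  by apply: (integrable_bounded_fun mD muD (m := 1)) => // x _; rewrite /= normr1.
have IMG0 : \int[mu]_(x in D) M `|G0 (f x)| <= A.
  have iq1 : mu.-integrable D (EFin \o (fun x => 1 + q (f x))).
    by have := integrableD mD i1 iq; apply: eq_integrable.
  have iq2 := integrable_scale mD (C ^+ 2 / J) iq1.
  have iM1 : mu.-integrable D (EFin \o cst (M 1)).
    by have := integrable_scale mD (M 1) i1; apply: eq_integrable => // x _; rewrite /= mulr1.
  apply: (@le_trans _ _ (\int[mu]_(x in D) (M 1 + C ^+ 2 / J * (1 + q (f x))))).
    apply: le_Rintegral => //.
    by have := integrableD mD iM1 iq2; apply: eq_integrable.
  rewrite RintegralD// RintegralZl// RintegralD// !Rintegral_cst// muD/= !mulr1 -/J.
  rewrite lerD2l mulrAC ler_pdivrMr//.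
  have : 0 < C ^+ 2 by rewrite exprn_gt0.
  nra.
set c := \int[mu]_(x in D) G0 (f x).
have cA : `|c| <= C * A.
  rewrite (le_trans (le_normr_Rintegral mD iG0))//.
  apply: (@le_trans _ _ (\int[mu]_(x in D) (C * M `|G0 (f x)|))).
    apply: le_Rintegral => //.
    - exact: integrable_norm.
    - exact: integrable_scale.
    - by move=> x _; exact: norm_le_gauge.
  by rewrite RintegralZl// ler_wpM2l// ltW.
have mGf : measurable_fun D (fun x => G0 (f x) - c) by exact: measurable_funB.
have Gm y : `|G0 y - c| <= m + `|c|.
  by rewrite (le_trans (ler_normB _ _))// lerD.
exists (fun y => G0 y - c), (m + `|c|); split => //.
- exact: measurable_funB.
(* Subtracting the constant c leaves the pairing unchanged, because f has mean zero. *)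
- transitivity (\int[mu]_(x in D) (eps / (2 * J) * q (f x) - c * f x)).
    apply: eq_Rintegral => x _; rewrite /G0 /q mulrBr [f x * (_ * _)]mulrCA.
    by rewrite [f x * (_ * _)]mulrA mul_odd_slope; field; rewrite gt_eqF.
  rewrite RintegralB//; try exact: integrable_scale.
  by rewrite !RintegralZl// f0 -/J mulr0 subr0; field; rewrite gt_eqF.
- rewrite RintegralB//; first by rewrite Rintegral_cst// muD mulr1 subrr.
  by have := integrable_scale mD c i1; apply: eq_integrable => // x _; rewrite /= mulr1.
apply: (@le_trans _ _ (\int[mu]_(x in D) (M (C * A) * M `|G0 (f x)|))).
  apply: le_Rintegral => //.
  - by apply: (integrable_gauge_norm mD muD gM (m := m + `|c|)).
  - exact: integrable_scale.
  - move=> x _; apply: (le_trans (gauge_homo gM (ler_normB _ _))).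
    rewrite (le_trans (gaugeD gM _ _))// mulrC ler_pM2r ?(gauge_gt0 gM)//.
    exact: gauge_homo gM _ _ cA.
by rewrite RintegralZl// /witness_cst mulrC ler_wpM2r// ltW// (gauge_gt0 gM).
Qed.

End witness.

(** * Lower bound for the averaged width *)

Section width.
Context d (T : measurableType d) (R : realType).
Variables (mu : {measure set T -> \bar R}) (D : set T).
Variables (Phi M : R -> R) (C eps : R).
Hypotheses (mD : measurable D) (muD : mu D = 1%E) (oPhi : orlicz_function Phi).
Hypotheses (C1 : 1 <= C) (eps0 : 0 < eps) (yM : young_gauge Phi C eps M).
Let gM := young_gauge_gauge yM.
Let C0 := witness_cst M C.
(** The outer C comes from Young's inequality; inside, 1 bounds the modular of h / l and the rest
    bounds the M-mass of a normalized combination. *)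
Definition coef_cst := C * (1 + M 1 * (2 * expR (weight_cst C M * C0))).

Lemma coef_cst_gt0 : 0 < coef_cst.
Proof.
have CC : 0 < C := lt_le_trans ltr01 C1.
rewrite mulr_gt0// addr_gt0// mulr_gt0 ?(gauge_gt0 gM)//.
by rewrite mulr_gt0// expR_gt0.
Qed.

Section coefficients.
Variables (N : nat) (f : 'I_N -> T -> R) (G : 'I_N -> R -> R) (m : 'I_N -> R).
Hypotheses (mf : forall k, measurable_fun D (f k)) (indep : independent_on mu D f).
Hypotheses (mG : forall k, measurable_fun setT (G k))
  (Gm : forall k y, `|G k y| <= m k)
  (G0 : forall k, \int[mu]_(x in D) G k (f k x) = 0)
  (MG : forall k, \int[mu]_(x in D) M `|G k (f k x)| <= C0).

Let mGf k : measurable_fun D (fun x => G k (f k x)).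
Proof. exact: measurableT_comp. Qed.

(* By duality: pair h with the normalized combination of the G k (f k). *)
Lemma sum_sqr_coef_le (h : T -> R) l : 0 < l -> measurable_fun D h ->
  (\int[mu]_(x in D) (Phi (`|h x| / l))%:E <= 1)%E ->
  \sum_k (\int[mu]_(x in D) (h x * G k (f k x))) ^+ 2 <= (coef_cst * l) ^+ 2.
Proof.
move=> l0 mh hl; have CC : 0 < C := lt_le_trans ltr01 C1.
have ih := integrable_of_orlicz mD muD oPhi l0 mh hl.
pose c k := \int[mu]_(x in D) (h x * G k (f k x)).
rewrite -/(\sum_k c k ^+ 2); set S := \sum_k c k ^+ 2.
have S0 : 0 <= S by apply: sumr_ge0 => k _; exact: sqr_ge0.
have [->|Sn0] := eqVneq S 0; first exact: sqr_ge0.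
have Sp : 0 < S by rewrite lt_neqAle eq_sym Sn0.
have sSp : 0 < Num.sqrt S by rewrite sqrtr_gt0.
have SS : Num.sqrt S ^+ 2 = S by rewrite sqr_sqrtr.
suff : Num.sqrt S <= coef_cst * l.
  move=> le1; rewrite -SS ler_pXn2r ?nnegrE ?(ltW sSp)//.
  by rewrite mulr_ge0 ?(ltW l0)// ltW// coef_cst_gt0.
pose a k := c k / Num.sqrt S.
have a1 : \sum_k a k ^+ 2 <= 1.
  under eq_bigr do rewrite exprMn exprVn SS.
  by rewrite -mulr_suml divff.
have := integral_gauge_norm_sum_le mD muD C1 gM (witness_cst_ge0 yM) mf indep mG Gm G0 MG a1.
set I := \int[mu]_(x in D) _ => I_le.
have mg : measurable_fun D (fun x => \sum_k a k * G k (f k x)).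
  by apply: measurable_sum => k; exact: measurable_funM.
have gb x : `|\sum_k a k * G k (f k x)| <= \sum_k `|a k| * m k.
  rewrite (le_trans (ler_norm_sum _ _ _))// ler_sum// => k _.
  by rewrite normrM ler_wpM2l.
have ihG k : mu.-integrable D (EFin \o (fun x => h x * G k (f k x))).
  exact: (integrable_mul_bounded mD (m := m k)).
have iP := integrable_orlicz_comp oPhi l0 mh hl.
have iM : mu.-integrable D (EFin \o (fun x => M `|\sum_k a k * G k (f k x)|)).
  by apply: (integrable_gauge_norm mD muD gM (m := \sum_k `|a k| * m k)).
have ihg : mu.-integrable D (EFin \o (fun x => h x * (\sum_k a k * G k (f k x)))).
  by apply: (integrable_mul_bounded mD (m := \sum_k `|a k| * m k)).
have -> : Num.sqrt S = \int[mu]_(x in D) (h x * (\sum_k a k * G k (f k x))).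
  transitivity (\int[mu]_(x in D) (\sum_k a k * (h x * G k (f k x)))); last first.
    apply: eq_Rintegral => x _; rewrite mulr_sumr; apply: eq_bigr => k _; ring.
  rewrite Rintegral_sum//; last by move=> k; exact: integrable_scale.
  under eq_bigr do rewrite RintegralZl//.
  rewrite (_ : \sum_i _ = S / Num.sqrt S); last first.
    by rewrite /S mulr_suml; apply: eq_bigr => k _; rewrite /a -/(c k); ring.
  by rewrite -[X in _ = X / _]SS expr2 mulfK// gt_eqF.
apply: (@le_trans _ _ (\int[mu]_(x in D)
    (l * C * (Phi (`|h x| / l) + M `|\sum_k a k * G k (f k x)|)))).
  apply: le_Rintegral => //.
    by apply: integrable_scale => //; have := integrableD mD iP iM; apply: eq_integrable.
  move=> x _; apply: le_trans (ler_norm _) _; rewrite normrM.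
  have := young_gaugeM yM (u := `|h x| / l) (v := `|\sum_k a k * G k (f k x)|).
  rewrite (divr_ge0 (normr_ge0 _) (ltW l0)) normr_ge0 => /(_ isT isT).
  by rewrite mulrAC ler_pdivrMr// => /le_trans; apply; rewrite mulrC mulrA.
rewrite RintegralZl//; last by have := integrableD mD iP iM; apply: eq_integrable.
rewrite RintegralD// -/I /coef_cst mulrC -mulrA [l * C]mulrC mulrA mulrCA.
rewrite [X in _ <= X](_ : _ = C * l * (1 + M 1 * (2 * expR (weight_cst C M * C0)))); last ring.
rewrite [X in X <= _](_ : _ = C * l * (\int[mu]_(x in D) Phi (`|h x| / l) + I)); last ring.
rewrite ler_pM2l ?mulr_gt0// lerD//.
by rewrite -lee_fin EFin_Rintegral.
Qed.

End coefficients.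

Lemma ae_eq_Rintegral_mul (v w g : T -> R) :
  measurable_fun D v -> measurable_fun D w -> measurable_fun D g ->
  {ae mu, forall x, D x -> v x = w x} ->
  \int[mu]_(x in D) (v x * g x) = \int[mu]_(x in D) (w x * g x).
Proof.
move=> mv mw mg vw; rewrite /Rintegral; congr fine.
apply: ae_eq_integral => //.
- by apply/measurable_EFinP; exact: measurable_funM.
- by apply/measurable_EFinP; exact: measurable_funM.
by apply: filterS vw => x vw Dx; rewrite (vw Dx).
Qed.

(** The distances are infima that need not be attained, so the estimate is made for arbitrary
    approximants and admissible radii. *)
Lemma sum_sqr_radius_ge N n (f : 'I_N -> T -> R) (V : set (T -> R))
    (v : 'I_N -> T -> R) (l : 'I_N -> R) :
  (forall k, orlicz_space mu D Phi (f k)) ->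
  (forall k, (1 <= luxemburg mu D Phi (f k))%E) ->
  (forall k, (\int[mu]_(x in D) (f k x)%:E = 0)%E) ->
  independent_on mu D f ->
  V `<=` orlicz_space mu D Phi -> subspace_dim_le mu D n V ->
  (forall k, V (v k)) -> (forall k, 0 < l k) ->
  (forall k, \int[mu]_(x in D) (Phi (`|f k x - v k x| / l k))%:E <= 1)%E ->
  (eps / 2 / coef_cst) ^+ 2 * (N%:R - n%:R) <= \sum_k l k ^+ 2.
Proof.
move=> fL f1 f0 indep VL [_ _ [g gV gspan]] vV l0 vl.
have mf k : measurable_fun D (f k) by have [] := fL k.
have iff k := orlicz_space_integrable mD muD oPhi (fL k).
have Rf0 k : \int[mu]_(x in D) f k x = 0 by rewrite /Rintegral f0.
have mv k : measurable_fun D (v k) by have [] := VL _ (vV k).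
have iv k := orlicz_space_integrable mD muD oPhi (VL _ (vV k)).
have mg i : measurable_fun D (g i) by have [] := VL _ (gV i).
have ig i := orlicz_space_integrable mD muD oPhi (VL _ (gV i)).
have /choice[G /choice[m Gm]] := fun k =>
  centred_witness mD muD oPhi C1 eps0 yM (mf k) (iff k) (Rf0 k) (f1 k).
have mG k : measurable_fun setT (G k) by have [] := Gm k.
have Gb k y : `|G k y| <= m k by have [] := Gm k.
have fG k : \int[mu]_(x in D) (f k x * G k (f k x)) = eps / 2 by have [] := Gm k.
have G0 k : \int[mu]_(x in D) G k (f k x) = 0 by have [] := Gm k.
have MG k : \int[mu]_(x in D) M `|G k (f k x)| <= C0 by have [] := Gm k.
have mGf k : measurable_fun D (fun x => G k (f k x)) by exact: measurableT_comp.
have /choice[a aP] := fun k => gspan _ (vV k).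
pose A := \matrix_(j, k) \int[mu]_(x in D) (v j x * G k (f k x)).
(* Each [v j] is a combination of the n functions [g i] up to a null set, so the pairing matrix
   factors through dimension n. *)
have rA : (\rank A <= n)%N.
  have -> : A = (\matrix_(j, i) a j i) *m
      (\matrix_(i, k) \int[mu]_(x in D) (g i x * G k (f k x))).
    apply/matrixP => j k; rewrite !mxE.
    have mag : measurable_fun D (fun x => \sum_i a j i * g i x).
      by apply: measurable_sum => i; exact: measurable_funM.
    rewrite (ae_eq_Rintegral_mul (mv j) mag (mGf k) (aP j)).
    transitivity (\int[mu]_(x in D) (\sum_i a j i * (g i x * G k (f k x)))).
      by apply: eq_Rintegral => x _; rewrite mulr_suml; apply: eq_bigr => i _; rewrite mulrA.
    have igG i : mu.-integrable D (EFin \o (fun x => g i x * G k (f k x))).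
      exact: (integrable_mul_bounded mD (m := m k)).
    rewrite Rintegral_sum//; last by move=> i; exact: integrable_scale.
    by apply: eq_bigr => i _; rewrite !mxE RintegralZl.
  exact: mulmx_max_rank.
have := sqnorm_scalar_sub_low_rank (eps / 2) rA.
have BE j k : ((eps / 2)%:M - A) j k
    = \int[mu]_(x in D) ((f j x - v j x) * G k (f k x)).
  have ifG : mu.-integrable D (EFin \o (fun x => f j x * G k (f k x))).
    exact: (integrable_mul_bounded mD (m := m k)).
  have ivG : mu.-integrable D (EFin \o (fun x => v j x * G k (f k x))).
    exact: (integrable_mul_bounded mD (m := m k)).
  rewrite !mxE; under [RHS]eq_Rintegral do rewrite mulrBl.
  rewrite RintegralB//; congr (_ - _).
  have [->|jk] := eqVneq j k; first by rewrite mulr1n fG.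
  by rewrite mulr0n (Rintegral_mean_zero_mul mD muD jk mf indep (mG k) (Gb k)).
have cp := coef_cst_gt0.
move=> low; have {low} : (eps / 2) ^+ 2 * (N%:R - n%:R) <= coef_cst ^+ 2 * \sum_k l k ^+ 2.
  (* Row j consists of the coefficients of h = f j - v j, to which the Bessel bound applies with
     radius l j. *)
  apply: (le_trans low); rewrite mulr_sumr; apply: ler_sum => j _.
  under eq_bigr do rewrite BE.
  rewrite -exprMn; apply: (sum_sqr_coef_le mf indep mG Gb G0 MG (l0 j)) => //.
  exact: measurable_funB.
move=> low; rewrite [_ / coef_cst]mulrC exprMn exprVn -mulrA mulrC ler_pdivrMr ?exprn_gt0//.
by rewrite [leRHS]mulrC.
Qed.

Lemma luxemburg_ge0 (h : T -> R) : (0 <= luxemburg mu D Phi h)%E.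
Proof. by apply: le_ereal_inf_tmp => _ [l [l0 _] <-]; rewrite lee_fin ltW. Qed.

Lemma orlicz_dist_ge0 (h : T -> R) V : (0 <= orlicz_dist mu D Phi h V)%E.
Proof. by apply: le_ereal_inf_tmp => _ [v _ <-]; exact: luxemburg_ge0. Qed.

Theorem avg_width_ge N n (f : 'I_N -> T -> R) : (n < N)%N ->
  (forall k, orlicz_space mu D Phi (f k)) ->
  (forall k, (1 <= luxemburg mu D Phi (f k))%E) ->
  (forall k, (\int[mu]_(x in D) (f k x)%:E = 0)%E) ->
  independent_on mu D f ->
  ((eps / 2 / coef_cst * Num.sqrt (1 - n%:R / N%:R))%:E <= avg_width mu D n f Phi)%E.
Proof.
move=> nN fL f1 f0 indep; apply: le_ereal_inf_tmp => _ [V [VL Vn] <-].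
set c := eps / 2 / coef_cst.
have c0 : 0 < c by rewrite !divr_gt0// coef_cst_gt0.
have N0 : 0 < N%:R :> R by rewrite ltr0n (leq_ltn_trans _ nN).
have [[k ky]|fin] := pselect (exists k, orlicz_dist mu D Phi (f k) V = +oo%E).
  rewrite (bigD1 k)//= ky addye; last first.
    rewrite gt_eqF// (lt_le_trans (ltNyr 0))//.
    by apply: sume_ge0 => i _; apply: sqre_ge0.
  by rewrite gt0_muley ?leey// lte_fin invr_gt0.
pose r k := fine (orlicz_dist mu D Phi (f k) V).
have rE k : orlicz_dist mu D Phi (f k) V = (r k)%:E.
  rewrite fineK// ge0_fin_numE ?orlicz_dist_ge0// ltey; apply/eqP => ky.
  by apply: fin; exists k.
have r0 k : 0 <= r k by rewrite fine_ge0// orlicz_dist_ge0.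
under eq_bigr do rewrite rE -EFin_expe.
rewrite sumEFin -EFinM/= lee_fin.
suff sum_ge : c ^+ 2 * (N%:R - n%:R) <= \sum_k r k ^+ 2.
  rewrite -[c]gtr0_norm// -sqrtr_sqr -sqrtrM ?sqr_ge0// ler_wsqrtr//.
  rewrite [leRHS]mulrC ler_pdivlMr// (le_trans _ sum_ge)//.
  by rewrite -mulrA mulrBl mul1r divfK ?gt_eqF.
apply/ler_addgt0Pr => e e0.
(* For del <= 1, (r + del)^2 <= r^2 + del (2 r + 1); summed over k, the loss is at most del K <=
   e. *)
pose K := 2 * \sum_k r k + N%:R.
have K0 : 0 < K by rewrite ltr_wpDl// mulr_ge0// sumr_ge0.
pose del := Num.min 1 (e / K).
have del0 : 0 < del by rewrite lt_min ltr01 divr_gt0.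
have near k : exists vl : (T -> R) * R, [/\ V vl.1, 0 < vl.2, vl.2 < r k + del &
    (\int[mu]_(x in D) (Phi (`|f k x - vl.1 x| / vl.2))%:E <= 1)%E].
  have : (orlicz_dist mu D Phi (f k) V < (r k + del)%:E)%E.
    by rewrite rE lte_fin ltrDl.
  move=> /ereal_inf_lt[_ [v Vv <-]] /luxemburg_lt_admissible[l [l0 lr lv]].
  by exists (v, l).
have [vl vlP] := choice near.
have := sum_sqr_radius_ge fL f1 f0 indep VL Vn
  (v := fun k => (vl k).1) (l := fun k => (vl k).2).
move=> /(_ _ _ _)/le_trans; apply.
- by move=> k; have [] := vlP k.
- by move=> k; have [] := vlP k.
- by move=> k; have [] := vlP k.
apply: (@le_trans _ _ (\sum_k (r k ^+ 2 + del * (2 * r k + 1)))).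
  apply: ler_sum => k _; have [_ l0 lr _] := vlP k.
  have d1 : del <= 1 by rewrite ge_min lexx.
  have rk := r0 k.
  apply: (@le_trans _ _ ((r k + del) ^+ 2)); last nra.
  by rewrite ler_pXn2r ?nnegrE ?ltW// ltr_wpDl.
rewrite big_split/= lerD2l -mulr_sumr big_split/= -mulr_sumr sumr_const card_ord -/K.
by rewrite -ler_pdivlMr// ge_min lexx orbT.
Qed.

End width.

(** * The gauge built from the conjugate function *)

Section conjugate_gauge.
Context (R : realType) (Phi : R -> R) (K1 K2 : R).
Hypothesis oPhi : orlicz_function Phi.
Hypotheses (K1_gt0 : 0 < K1) (K2_gt0 : 0 < K2).
Hypothesis Phi_quad :
  forall a u : R, 1 <= a -> 1 <= u -> Phi (a * u) <= K1 * a ^+ 2 * Phi u.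
Hypothesis conjD : forall u v : R, 1 <= u -> 1 <= v ->
  (orlicz_conjugate Phi (u + v)
     <= K2%:E * orlicz_conjugate Phi u * orlicz_conjugate Phi v)%E.

Lemma orlicz_conjugate_ge u t : 0 < t ->
  ((u * t - Phi t)%:E <= orlicz_conjugate Phi u)%E.
Proof.
move=> t0; apply: ereal_sup_ubound; exists t => //=.
by rewrite in_itv/= t0.
Qed.

Lemma orlicz_conjugate_le u (B : R) : (forall t, 0 < t -> u * t - Phi t <= B) ->
  (orlicz_conjugate Phi u <= B%:E)%E.
Proof.
move=> uB; apply: ge_ereal_sup => _ [t /= + <-].
by rewrite in_itv/= andbT => t0; rewrite lee_fin uB.
Qed.

Lemma orlicz_conjugate_ge0 u : 1 <= u -> (0 <= orlicz_conjugate Phi u)%E.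
Proof.
move=> u1; apply: (le_trans _ (orlicz_conjugate_ge u ltr01)).
by rewrite lee_fin mulr1 (orlicz1 oPhi) subr_ge0.
Qed.

Lemma orlicz_conjugate1_le : (orlicz_conjugate Phi 1 <= 1)%E.
Proof.
apply: orlicz_conjugate_le => t t0.
by rewrite mul1r lerBlDr (orlicz_ge_id_sub1 oPhi)// ltW.
Qed.

Lemma orlicz_conjugate_homo u v : u <= v ->
  (orlicz_conjugate Phi u <= orlicz_conjugate Phi v)%E.
Proof.
move=> uv; apply: ge_ereal_sup => _ [t /= + <-].
rewrite in_itv/= andbT => t0; apply: (le_trans _ (orlicz_conjugate_ge v t0)).
by rewrite lee_fin lerB// ler_wpM2r// ltW.
Qed.

(** The value at 1 is at most 1; submultiplicativity with v = 1 propagates finiteness to all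
    integers, and monotonicity fills the gaps. *)
Lemma orlicz_conjugate_fin_num u : 1 <= u -> orlicz_conjugate Phi u \is a fin_num.
Proof.
move=> u1; rewrite ge0_fin_numE ?orlicz_conjugate_ge0//.
have nat_lty (n : nat) : (orlicz_conjugate Phi n.+1%:R < +oo)%E.
  elim: n => [|n ih]; first exact: le_lt_trans orlicz_conjugate1_le (ltry _).
  have n1 : 1 <= n.+1%:R :> R by rewrite ler1n.
  rewrite -natr1 (le_lt_trans (conjD n1 (lexx 1)))//.
  have cn : (0 <= orlicz_conjugate Phi n.+1%:R)%E := orlicz_conjugate_ge0 n1.
  apply: lte_mul_pinfty.
  - by rewrite mule_ge0// lee_fin ltW.
  - by rewrite fin_numM// ge0_fin_numE.
  - exact: le_lt_trans orlicz_conjugate1_le (ltry _).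
have /andP[_ /ltW un] := truncn_itv (le_trans ler01 u1).
exact: le_lt_trans (orlicz_conjugate_homo un) (nat_lty _).
Qed.

(** Freezing the conjugate below 1 extends submultiplicativity to all nonnegative arguments. *)
Let psi u := fine (orlicz_conjugate Phi (Num.max u 1)).

Let psiE u : (psi u)%:E = orlicz_conjugate Phi (Num.max u 1).
Proof. by rewrite fineK// orlicz_conjugate_fin_num// le_max lexx orbT. Qed.

Let psi_le u (B : R) : (forall t, 0 < t -> Num.max u 1 * t - Phi t <= B) -> psi u <= B.
Proof. by move=> uB; rewrite -lee_fin psiE orlicz_conjugate_le. Qed.

Let psi_ge u t : 0 < t -> Num.max u 1 * t - Phi t <= psi u.
Proof. by move=> t0; rewrite -lee_fin psiE orlicz_conjugate_ge. Qed.

Let psi_homo : {homo psi : u v / u <= v}.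
Proof.
move=> u v uv; rewrite -lee_fin !psiE orlicz_conjugate_homo//.
by rewrite ge_max !le_max uv lexx orbT.
Qed.

Let psi_ge0 u : 0 <= psi u.
Proof. by rewrite fine_ge0// orlicz_conjugate_ge0// le_max lexx orbT. Qed.

Let psiD u v : 0 <= u -> 0 <= v -> psi (u + v) <= K2 * psi u * psi v.
Proof.
move=> u0 v0; rewrite -lee_fin !EFinM !psiE.
have u1 : 1 <= Num.max u 1 by rewrite le_max lexx orbT.
have v1 : 1 <= Num.max v 1 by rewrite le_max lexx orbT.
apply: le_trans (conjD u1 v1); apply: orlicz_conjugate_homo.
rewrite ge_max lerD ?le_max ?lexx//=.
by apply: le_trans u1 _; rewrite lerDl (le_trans ler01 v1).
Qed.

(** The conjugate at 2 is at least 2 - Phi 1 = 1 and at most K2 (psi 1)^2. *)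
Let psi1_gt0 : 0 < psi 1.
Proof.
have : 1 <= psi (1 + 1).
  by have := psi_ge (1 + 1) ltr01; rewrite max_l ?lerDl// (orlicz1 oPhi); lra.
have := psiD ler01 ler01; rewrite lt0r psi_ge0 andbT.
by case: eqVneq => // ->; rewrite !mulr0 => h1 /le_trans/(_ h1); rewrite ler10.
Qed.

Let psi1_le u : psi 1 <= psi u.
Proof.
by rewrite -lee_fin !psiE orlicz_conjugate_homo// max_l// le_max lexx orbT.
Qed.

(** K2 gives submultiplicativity of K psi, 1 / psi 1 gives M >= 1, and 1 gives psi <= M. *)
Let K := K2 + (psi 1)^-1 + 1.
(** The two summands serve the ranges t >= 1 and t < 1 of the supremum in [M_quad]. *)
Let L := (1 + K1) + 4 * (1 + K1) ^+ 2.
Let M u := K * psi u.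

Let ipsi1_gt0 : 0 < (psi 1)^-1. Proof. by rewrite invr_gt0. Qed.
Let K_ge1 : 1 <= K. Proof. by rewrite lerDr addr_ge0// ltW. Qed.
Let K2_le : K2 <= K. Proof. by rewrite /K -addrA lerDl addr_ge0// ltW. Qed.
Let ipsi1_le : (psi 1)^-1 <= K.
Proof. by rewrite /K addrAC lerDr addr_ge0// ltW. Qed.
Let L_ge1 : 1 <= L.
Proof. by rewrite /L; have := sqr_ge0 (1 + K1); have := K1_gt0; lra. Qed.

Let M_ge1 u : 1 <= M u.
Proof.
by rewrite -(mulVf (x := psi 1)) ?gt_eqF// ler_pM// ltW.
Qed.

Let psi_le_M u : psi u <= M u.
Proof. by rewrite ler_peMl. Qed.

(* Phi grows at most quadratically, so its conjugate grows at least so. *)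
Let sqr_le_M u : 1 <= u -> u ^+ 2 <= 4 * (1 + K1) ^+ 2 * M u.
Proof.
move=> u1; have K1p := K1_gt0.
set k := 1 + K1; have k1 : 1 < k by rewrite ltrDl.
have Mu := M_ge1 u.
have [uk|ku] := leP u (2 * k).
  have : u ^+ 2 <= (2 * k) ^+ 2 by rewrite ler_pXn2r ?nnegrE//; lra.
  have : 4 * k ^+ 2 <= 4 * k ^+ 2 * M u by rewrite ler_peMr// mulr_ge0// sqr_ge0.
  by lra.
(* The maximizer of u t - k t^2, where k t^2 majorizes Phi t; u > 2 k ensures t >= 1. *)
pose t := u / (2 * k).
have t1 : 1 <= t by rewrite ler_pdivlMr; lra.
have t0 : 0 < t by lra.
have ut : u = 2 * k * t by rewrite /t; field; lra.
have := psi_ge u t0; rewrite max_l// => h.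
have := Phi_quad t1 (lexx 1); rewrite mulr1 (orlicz1 oPhi) mulr1 => Pt.
have t2 : 0 < t ^+ 2 by rewrite exprn_gt0.
have kt : K1 * t ^+ 2 <= k * t ^+ 2 by rewrite ler_wpM2r ?(ltW t2)// /k lerDr.
have ut2 : u * t = 2 * (k * t ^+ 2) by rewrite {1}ut; ring.
have kM : k * t ^+ 2 <= M u by apply: le_trans (psi_le_M u); lra.
have : 4 * k ^+ 2 * t ^+ 2 <= 4 * k ^+ 2 * (k * t ^+ 2).
  by apply: ler_wpM2l; [rewrite mulr_ge0// sqr_ge0|rewrite ler_peMl// ltW].
have : 4 * k ^+ 2 * (k * t ^+ 2) <= 4 * k ^+ 2 * M u.
  by rewrite ler_wpM2l// mulr_ge0// sqr_ge0.
have -> : u ^+ 2 = 4 * k ^+ 2 * t ^+ 2 by rewrite {1}ut; ring.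
by lra.
Qed.

Let M_quad a u : 0 < a <= 1 -> 1 <= a * u -> M (a * u) <= K * L * a ^+ 2 * M u.
Proof.
move=> /andP[a0 a1] au1; have K1p := K1_gt0.
set k := 1 + K1; have k1 : 1 < k by rewrite ltrDl.
have u0 : 0 < u by rewrite -(pmulr_rgt0 _ a0) (lt_le_trans ltr01).
have u1 : 1 <= u by rewrite (le_trans au1)// ler_piMl// ltW.
have K0 : 0 < K := lt_le_trans ltr01 K_ge1.
have Mu := M_ge1 u; have a2 : 0 < a ^+ 2 by rewrite exprn_gt0.
have a2M : 0 < a ^+ 2 * M u by rewrite mulr_gt0//; lra.
rewrite -!mulrA ler_pM2l//; apply: psi_le => t t0; rewrite max_l//.
have [t1|/ltW t1] := leP 1 t; last first.
  have Pt := orlicz_ge0 oPhi (ltW t0).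
  have : a * u * t <= a * u by rewrite ler_piMr// mulr_ge0 ?(ltW a0) ?(ltW u0).
  have : a * u <= a * u * (a * u) by rewrite ler_peMl// (le_trans ler01).
  have : a ^+ 2 * u ^+ 2 <= a ^+ 2 * (4 * k ^+ 2 * M u).
    by rewrite ler_wpM2l ?(ltW a2)// sqr_le_M.
  have : 0 <= k * (a ^+ 2 * M u) by rewrite mulr_ge0 ?(ltW a2M)//; lra.
  by rewrite /L -/k; lra.
(* With this s, k a^2 u s = a u t, so the supremum for a u reduces to that for u once k a^2 Phi s <=
   Phi t. *)
pose s := t / (a * k); have ak0 : 0 < a * k by rewrite mulr_gt0//; lra.
have s0 : 0 < s by rewrite divr_gt0.
have := psi_ge u s0; rewrite max_l// => us.
have Pt : 0 <= Phi t by rewrite (orlicz_ge0 oPhi)// ltW.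
have key : k * a ^+ 2 * Phi s <= Phi t.
  (* If a k <= 1 then s >= t, and quadratic growth gives the ratio K1 / k < 1; otherwise s <= t, and
     convexity through the origin gives the ratio a <= 1. *)
  have [ak|/ltW ak] := leP (a * k) 1.
    have := Phi_quad (a := (a * k)^-1) _ t1.
    rewrite invf_ge1// => /(_ ak); rewrite [_^-1 * t]mulrC -/s => Ps.
    apply: (@le_trans _ _ (k * a ^+ 2 * (K1 * (a * k)^-1 ^+ 2 * Phi t))).
      by rewrite ler_wpM2l// mulr_ge0 ?sqr_ge0//; lra.
    rewrite [leLHS](_ : _ = K1 / k * Phi t); last by field; rewrite !gt_eqF//; lra.
    by rewrite ler_piMl// ler_pdivrMr; rewrite /k; lra.
  have := orlicz_scale_le oPhi (a := (a * k)^-1) (u := t).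
  rewrite invr_ge0 (ltW ak0) invf_le1// ak => /(_ isT (ltW t0)).
  rewrite [_^-1 * t]mulrC -/s => Ps.
  apply: (@le_trans _ _ (k * a ^+ 2 * ((a * k)^-1 * Phi t))).
    by rewrite ler_wpM2l// mulr_ge0 ?sqr_ge0//; lra.
  rewrite [leLHS](_ : _ = a * Phi t); last by field; rewrite !gt_eqF//; lra.
  by rewrite ler_piMl.
have : k * a ^+ 2 * (u * s - Phi s) <= k * a ^+ 2 * psi u.
  by rewrite ler_wpM2l// mulr_ge0 ?sqr_ge0//; lra.
have -> : k * a ^+ 2 * (u * s - Phi s) = a * u * t - k * a ^+ 2 * Phi s.
  by rewrite /s; field; rewrite !gt_eqF//; lra.
have : k * a ^+ 2 * psi u <= k * a ^+ 2 * M u.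
  by rewrite ler_wpM2l// mulr_ge0 ?sqr_ge0//; lra.
have : 0 <= 4 * k ^+ 2 * (a ^+ 2 * M u) by rewrite mulr_ge0 ?(ltW a2M)// mulr_ge0// sqr_ge0.
by rewrite /L -/k; lra.
Qed.

Lemma young_gauge_conjugate :
  exists C, exists2 M : R -> R, 1 <= C & young_gauge Phi C 1 M.
Proof.
have K0 : 0 < K := lt_le_trans ltr01 K_ge1.
have KL1 : 1 <= K * L by rewrite mulr_ege1.
have KKL : K <= K * L by rewrite ler_peMr// ltW.
exists (K * L), M => //; split; first split => //.
- by move=> u v uv; rewrite ler_wpM2l ?(ltW K0)// psi_homo.
- move=> u v u0 v0; apply: (@le_trans _ _ (K * (K2 * psi u * psi v))).
    by rewrite ler_wpM2l ?(ltW K0)// psiD.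
  have : K2 * (psi u * psi v) <= K * (psi u * psi v).
    by rewrite ler_wpM2r ?mulr_ge0.
  by move=> h; rewrite /M -mulrA [leRHS]mulrACA -[leRHS]mulrA ler_wpM2l// ltW.
- move=> u v u0 v0.
  have Pu := orlicz_ge0 oPhi u0; have Mv := M_ge1 v.
  apply: (@le_trans _ _ (Phi u + M v)); last by rewrite ler_peMl//; lra.
  move: u0; rewrite le_eqVlt => /predU1P[<-|u0]; first by rewrite mul0r (orlicz0 oPhi); lra.
  have := psi_ge v u0; have := psi_le_M v.
  have : v * u <= Num.max v 1 * u by rewrite ler_wpM2r ?(ltW u0)// le_max lexx.
  by lra.
move=> t t0; rewrite mul1r.
have Pt := orlicz_ge0 oPhi t0.
apply: (@le_trans _ _ (K * (1 + Phi t))); last by rewrite ler_wpM2r//; lra.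
rewrite ler_pM2l//; apply: psi_le => s s0.
have Ps := orlicz_ge0 oPhi (ltW s0).
have s1 := orlicz_ge_id_sub1 oPhi (ltW s0).
have [_|] := leP (Phi t / t) 1; first by lra.
move: t0; rewrite le_eqVlt => /predU1P[<-|t0 _]; first by rewrite invr0 mulr0 ltr10.
(* Let c = Phi t / t. For s <= t, c s <= c t = Phi t; for s >= t, c s <= Phi s because secant slopes
   increase. *)
have [st|/ltW ts] := leP s t.
  have : Phi t / t * s <= Phi t / t * t by rewrite ler_wpM2l// divr_ge0// ltW.
  by rewrite divfK ?gt_eqF//; lra.
have := orlicz_slope_le oPhi t0 ts; rewrite ler_pdivlMr//; lra.
Qed.

End conjugate_gauge.

(** * The gauge for L log^alpha L *)

Section exponential_gauge.
Context (R : realType).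
Implicit Types (a b u v x : R).

(** A fraction in [0, 1] is at most its power b, and the fractions of u and v in u + v add up to 1.
    With b = 1 / alpha this makes the exponential gauge submultiplicative. *)
Lemma powR_subadditive b u v : 0 < b <= 1 -> 0 <= u -> 0 <= v ->
  (u + v) `^ b <= u `^ b + v `^ b.
Proof.
move=> /andP[b0 b1]; rewrite le_eqVlt => /predU1P[<-|u0].
  by rewrite add0r lerDr powR_ge0.
rewrite le_eqVlt => /predU1P[<-|v0]; first by rewrite addr0 lerDl powR_ge0.
have s0 : 0 < u + v by rewrite addr_gt0.
have frac x : 0 < x -> x <= u + v -> x / (u + v) * (u + v) `^ b <= x `^ b.
  move=> x0 xs; have q0 : 0 < x / (u + v) by rewrite divr_gt0.
  have -> : x `^ b = (x / (u + v)) `^ b * (u + v) `^ b.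
    by rewrite -powRM ?divfK ?gt_eqF// ltW.
  rewrite ler_wpM2r ?powR_ge0//.
  by rewrite ger1_powR// q0 ler_pdivrMr// mul1r.
rewrite -[leLHS]mul1r -(divff (x := u + v)) ?gt_eqF// mulrDl mulrDl.
by rewrite lerD// frac// ?lerDl ?lerDr ltW.
Qed.

Lemma le_mul_expR_div a x : 1 <= a -> 0 <= x -> x <= a * expR (x / a).
Proof.
move=> a1 x0; have a0 : 0 < a by rewrite (lt_le_trans ltr01).
rewrite mulrC -ler_pdivrMr//; apply: le_trans (expR_ge1Dx _).
by rewrite lerDr.
Qed.

Lemma powR_le_expR a x : 1 <= a -> 0 <= x -> x `^ a <= a `^ a * expR x.
Proof.
move=> a1 x0; have a0 : 0 < a by rewrite (lt_le_trans ltr01).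
apply: (@le_trans _ _ ((a * expR (x / a)) `^ a)).
  by apply: ge0_ler_powR; rewrite ?nnegrE ?mulr_ge0 ?expR_ge0 ?(ltW a0)// le_mul_expR_div.
by rewrite powRM ?expR_ge0 ?(ltW a0)// -expRM divfK// gt_eqF.
Qed.

Variables (alpha : R) (Phi : R -> R) (C0 u0 : R).
Hypotheses (alpha1 : 1 <= alpha) (oPhi : orlicz_function Phi).
Hypotheses (C0_gt0 : 0 < C0) (u0_ge1 : 1 <= u0).
Hypothesis Phi_LlogL : forall u, u0 <= u ->
  C0^-1 * (u * ln u `^ alpha) <= Phi u <= C0 * (u * ln u `^ alpha).

Let beta := alpha^-1.
Let alpha0 : 0 < alpha. Proof. exact: lt_le_trans ltr01 alpha1. Qed.
Let beta01 : 0 < beta <= 1. Proof. by rewrite invr_gt0 alpha0 invf_le1. Qed.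

Let p (u : R) := Num.max u 0 `^ beta.
(** The conjugate of u ln^alpha u grows roughly like the exponential of u^(1 / alpha). The factor 2
    leaves room in Young's inequality: one exp (p v) bounds u, the other bounds v up to [A]. *)
Let M (u : R) := expR (2 * p u).

Let p_ge0 u : 0 <= p u. Proof. exact: powR_ge0. Qed.

Let p_homo : {homo p : u v / u <= v}.
Proof.
have m0 x : Num.max x 0 \in Num.nneg by rewrite nnegrE le_max lexx orbT.
have /andP[/ltW b0 _] := beta01.
move=> u v uv; apply: ge0_ler_powR => //.
by rewrite ge_max !le_max uv lexx orbT.
Qed.

Let M_homo : {homo M : u v / u <= v}.
Proof. by move=> u v uv; rewrite ler_expR ler_wpM2l// p_homo. Qed.

Let M_ge1 u : 1 <= M u.
Proof. by rewrite -expR0 ler_expR mulr_ge0. Qed.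

Let powR_p u : 0 <= u -> p u `^ alpha = u.
Proof. by move=> u1; rewrite /p max_l// -powRrM mulVf ?gt_eqF// powRr1. Qed.

Let A := alpha `^ alpha.
Let A_ge1 : 1 <= A.
Proof.
have : 1 `^ alpha <= alpha `^ alpha :> R.
  by apply: ge0_ler_powR; rewrite ?nnegrE// ltW.
by rewrite powR1.
Qed.

Let M_quad a u : 0 < a <= 1 -> 1 <= a * u -> M (a * u) <= A ^+ 2 * a ^+ 2 * M u.
Proof.
move=> /andP[a0 a1] au1.
have u0' : 0 < u by rewrite -(pmulr_rgt0 _ a0) (lt_le_trans ltr01).
have au0 : 0 < a * u by rewrite mulr_gt0.
have au : a * u <= u by rewrite ler_piMl// ltW.
set s := p (a * u); set t := p u.
have st : s <= t by exact: p_homo.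
have s1 : 1 <= s.
  have e1 : 1 `^ beta = 1 :> R by rewrite powR1.
  by rewrite -[leLHS]e1 /s /p max_l ?(ltW au0)// ge0_ler_powR ?nnegrE ?(ltW au0)//;
    have /andP[/ltW] := beta01.
have key : u <= A * expR (t - s) * (a * u).
  rewrite -[leLHS](powR_p (ltW u0')) -[X in _ * X](powR_p (ltW au0)) -/s -/t.
  (* As s >= 1, t = s + (t - s) <= (alpha + (t - s)) s; raised to the power alpha, this bounds 1 / a
     by A exp (t - s). *)
  have ts : t <= (alpha * expR ((t - s) / alpha)) * s.
    have h := expR_ge1Dx ((t - s) / alpha).
    have : alpha + (t - s) <= alpha * expR ((t - s) / alpha).
      rewrite -[X in X + _]mulr1 -[X in _ + X <= _](divfK (x := alpha)) ?gt_eqF//.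
      by rewrite [X in _ + X <= _]mulrC -mulrDr ler_pM2l.
    have := alpha1; nra.
  rewrite -[expR (t - s)](_ : expR ((t - s) / alpha) `^ alpha = _); last first.
    by rewrite -expRM divfK ?gt_eqF.
  rewrite -!powRM ?mulr_ge0 ?expR_ge0 ?(ltW alpha0)// ?(le_trans ler01 s1)//.
  have rhs0 : 0 <= alpha * expR ((t - s) / alpha) * s.
    by rewrite mulr_ge0 ?p_ge0// mulr_ge0 ?expR_ge0 ?(ltW alpha0).
  by rewrite ge0_ler_powR ?nnegrE ?(ltW alpha0) ?p_ge0.
have {}key : 1 <= A * a * expR (t - s).
  by rewrite -(ler_pM2r u0') mul1r (le_trans key)//; lra.
have : 1 <= (A * a * expR (t - s)) ^+ 2 by rewrite exprn_ege1.
rewrite exprMn -expRM_natl => h.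
have -> : M u = expR (2 * (t - s)) * M (a * u).
  by rewrite /M -expRD -/s -/t; congr expR; ring.
rewrite mulrA ler_peMl ?expR_ge0//.
by rewrite -exprMn.
Qed.

(** Cancels [C0] and turns (ln t)^alpha into (ln t / 2)^alpha, whose image under [M] is exactly
    t. *)
Let eps := C0^-1 * 2^-1 `^ alpha.
Let K := M (eps * (Phi u0 / u0)).

Let eps_gt0 : 0 < eps.
Proof. by rewrite mulr_gt0 ?invr_gt0// powR_gt0// invr_gt0. Qed.

Let A_gt0 : 0 < A. Proof. exact: lt_le_trans ltr01 A_ge1. Qed.

Let u0_gt0 : 0 < u0. Proof. exact: lt_le_trans ltr01 u0_ge1. Qed.

Let M_mul_le C u v : C0 <= C -> u0 * A <= C -> 0 <= u -> 0 <= v ->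
  u * v <= C * (Phi u + M v).
Proof.
move=> C0C AC u1 v1; set P := p v.
have Pu := orlicz_ge0 oPhi u1; have eP := expR_gt0 P.
have Mv : 0 <= M v := le_trans ler01 (M_ge1 v).
have P0 : 0 <= P := p_ge0 v.
have MP : M v = expR P * expR P by rewrite -expRD /M -/P mulr_natl mulr2n.
have vA : v <= A * expR P by rewrite -[leLHS](powR_p v1) powR_le_expR.
have eM : expR P <= M v by rewrite MP ler_peMl ?(ltW eP)// -expR0 ler_expR.
have C00 : 0 <= C := le_trans (ltW C0_gt0) C0C.
suff : u * v <= u0 * A * M v \/ u * v <= C0 * Phi u.
  case=> /le_trans; apply.
    by apply: (ler_pM _ Mv AC); [rewrite mulr_ge0// ltW|rewrite lerDr].
  by apply: (ler_pM (ltW C0_gt0) Pu C0C); rewrite lerDl.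
(* Above exp P one has P <= ln u, hence v = P^alpha <= (ln u)^alpha, and the lower bound on [Phi]
   applies once u >= u0. *)
have [uP|Pu1] := leP u (expR P).
  left; apply: (@le_trans _ _ (expR P * (A * expR P))); first exact: ler_pM.
  by rewrite mulrCA -MP; apply: ler_wpM2r => //; rewrite ler_peMl// ltW.
have [uu0|/ltW uu0] := leP u0 u; last first.
  left; apply: (@le_trans _ _ (u0 * (A * expR P))); first exact: ler_pM.
  by rewrite mulrA; apply: ler_wpM2l => //; rewrite mulr_ge0// ltW.
right.
have up : 0 < u := lt_trans eP Pu1.
have Pln : P <= ln u by rewrite -[P]expRK ler_ln ?posrE// ltW.
have vln : v <= ln u `^ alpha.
  rewrite -[leLHS](powR_p v1) ge0_ler_powR ?nnegrE ?(ltW alpha0)//.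
  exact: le_trans P0 Pln.
have /andP[lo _] := Phi_LlogL uu0.
by rewrite -ler_pdivrMl// (le_trans _ lo)// ler_pM2l ?invr_gt0// ler_pM2l.
Qed.

Let M_slope_le t : 0 <= t -> M (eps * (Phi t / t)) <= K * (1 + Phi t).
Proof.
move=> t0; have Pt := orlicz_ge0 oPhi t0.
have K1 : 1 <= K := M_ge1 _.
have [tu0|/ltW ut0] := leP t u0.
  apply: (@le_trans _ _ K); last by rewrite ler_peMr ?lerDl// (le_trans ler01).
  apply: M_homo; apply: ler_wpM2l; first exact: ltW.
  move: t0; rewrite le_eqVlt => /predU1P[<-|t0]; last exact: orlicz_slope_le.
  by rewrite invr0 mulr0 divr_ge0 ?(orlicz_ge0 oPhi)// ltW.
have t1 : 1 <= t := le_trans u0_ge1 ut0.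
have tp : 0 < t := lt_le_trans ltr01 t1.
have ln0 : 0 <= ln t by rewrite ln_ge0.
apply: (@le_trans _ _ t); last first.
  apply: (le_trans (orlicz_ge_id oPhi t1)).
  apply: (@le_trans _ _ (1 + Phi t)); first by rewrite lerDr.
  by rewrite ler_peMl// addr_ge0.
have /andP[_ hi] := Phi_LlogL ut0.
have h : eps * (Phi t / t) <= (ln t / 2) `^ alpha.
  rewrite powRM ?invr_ge0// [leRHS]mulrC /eps -mulrA mulrCA.
  apply: ler_wpM2l; first exact: powR_ge0.
  by rewrite mulrC ler_pdivrMr// ler_pdivrMr// (le_trans hi)//; lra.
apply: (le_trans (M_homo h)).
rewrite -[leRHS](lnK (x := t)) ?posrE// /M ler_expR.
rewrite /p max_l ?powR_ge0// -powRrM divff ?gt_eqF// powRr1 ?divr_ge0//.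
by rewrite mulrC divfK.
Qed.

Lemma young_gauge_LlogL :
  exists C e, exists2 M : R -> R, 1 <= C /\ 0 < e & young_gauge Phi C e M.
Proof.
have [C [C1 C2 C3 [C4 C5]]] : exists C,
    [/\ 1 <= C, A ^+ 2 <= C, C0 <= C & u0 * A <= C /\ K <= C].
  have K1 : 1 <= K := M_ge1 _; have C0p := C0_gt0.
  have u0A : 0 < u0 * A by rewrite mulr_gt0.
  have AA := sqr_ge0 A.
  exists (A ^+ 2 + C0 + u0 * A + K).
  by move: (A ^+ 2) (u0 * A) (K) K1 u0A AA => a b k *; split; [| | |split]; lra.
exists C, eps, M; first by split.
split; [split|..].
- exact: M_ge1.
- exact: M_homo.
- move=> u v u1 v1; rewrite /M -expRD ler_expR -mulrDr; apply: ler_wpM2l => //.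
  by rewrite /p !max_l ?addr_ge0// powR_subadditive.
- move=> a u a01 au1; apply: (le_trans (M_quad a01 au1)).
  by apply: ler_wpM2r; [exact: expR_ge0|apply: ler_wpM2r; [exact: sqr_ge0|]].
- by move=> u v; exact: M_mul_le.
- move=> t t0; apply: (le_trans (M_slope_le t0)); apply: ler_wpM2r => //.
  by rewrite addr_ge0// (orlicz_ge0 oPhi).
Qed.

End exponential_gauge.

(** * Specialization to Lebesgue measure on the unit interval *)

Lemma measurable_unit_itv (R : realType) : measurable (unit_itv R).
Proof. by apply: sub_caratheodory; exact: measurable_itv. Qed.

Lemma completed_lebesgue_measure_unit_itv (R : realType) :
  completed_lebesgue_measure (unit_itv R) = 1%E.
Proof.
transitivity (@lebesgue_measure R `[0, 1]%classic) => //.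
by rewrite lebesgue_measure_itv/= lte_fin ltr01 sube0.
Qed.

Lemma avg_width_bounded_below_of_gauge (R : realType) (Phi M : R -> R) C eps :
  orlicz_function Phi -> 1 <= C -> 0 < eps -> young_gauge Phi C eps M ->
  avg_width_bounded_below Phi.
Proof.
move=> oPhi C1 eps0 yM; exists (eps / 2 / coef_cst M C).
  by rewrite !divr_gt0// (coef_cst_gt0 C1 yM).
move=> N n f nN fL f1 f0 indep.
have := avg_width_ge (@measurable_unit_itv R)
  (@completed_lebesgue_measure_unit_itv R) oPhi C1 eps0 yM nN fL f1 f0 indep.
by [].
Qed.

Theorem corollary3p7 (R : realType) :
  (forall Phi : R -> R,
    orlicz_function Phi ->
    (exists2 K1 : R, 0 < K1 &
      forall a u : R, 1 <= a -> 1 <= u -> Phi (a * u) <= K1 * a ^+ 2 * Phi u) ->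
    (exists2 K2 : R, 0 < K2 &
      forall u v : R, 1 <= u -> 1 <= v ->
        (orlicz_conjugate Phi (u + v)
           <= K2%:E * orlicz_conjugate Phi u * orlicz_conjugate Phi v)%E) ->
    avg_width_bounded_below Phi)
  /\
  (forall (alpha : R) (Phi : R -> R),
    1 <= alpha -> orlicz_function Phi -> equiv_LlogL alpha Phi ->
    avg_width_bounded_below Phi).
Proof.
split=> [Phi oPhi [K1 K10 quad] [K2 K20 conjD]|alpha Phi alpha1 oPhi [C C0 near]].
  have [C [M C1 yM]] := young_gauge_conjugate oPhi K10 K20 quad conjD.
  exact: avg_width_bounded_below_of_gauge oPhi C1 ltr01 yM.
(* The eventual bound holds for u > B strictly, hence B + 1; the maximum with 1 keeps ln u
   nonnegative. *)
have [B [_ BP]] := near; pose u0 := Num.max (B + 1) 1.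
have u01 : 1 <= u0 by rewrite le_max lexx orbT.
have u0P u : u0 <= u -> C^-1 * (u * ln u `^ alpha) <= Phi u <= C * (u * ln u `^ alpha).
  by rewrite ge_max => /andP[Bu _]; apply: BP; rewrite (lt_le_trans _ Bu)// ltrDl.
have [C' [e [M [C1 e0] yM]]] := young_gauge_LlogL alpha1 oPhi C0 u01 u0P.
exact: avg_width_bounded_below_of_gauge oPhi C1 e0 yM.
Qed.
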